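(* Let $n,p$ be positive integers and let $\sigma>0$. Let $\mu\in\mathbb{R}^n$ and let $\mathbb{X}$ be any (deterministic) real matrix of size $n\times p$. Assume that $\mu=\mathbb{X}\beta^*$ for some $\beta^*\in\mathbb{R}^p$ and let $s=|\beta^*|_0$. Let $y=\mu+\xi$, and assume that $\xi\sim\mathcal{N}(0,\sigma^2I_{n\times n})$ and that the Restricted Eigenvalue condition $RE(s,3)$ is satisfied, i.e. $\kappa(s,3)>0$ with $\kappa$ defined in the context. Let $\phi_{\max}$ be the largest eigenvalue of $\mathbb{X}^T\mathbb{X}/n$. Let $\lambda_0>\dots>\lambda_K$ be the knots of the Lasso path (defined in the context), let $$\hat F=\{\mathrm{supp}(\hat\beta^{L}_{\lambda_j}):\ j=0,\dots,K\}$$ be the family of all supports that appear on the Lasso path, and let $\hat\mu^Q$ be the estimator built from $\hat F$ and $\sigma^2$ defined in the context. Then for all $x>0$, the estimator $\hat\mu^Q$ satisfies, with probability greater than $1-3\exp(-x)$, $$\|\hat\mu^Q-\mathbb{X}\beta^*\|^2\le\frac{(128+48\phi_{\max})\sigma^2s\log p}{\kappa^2(s,3)\,n}+\frac{24\sigma^2}{n}+\frac{128\sigma^2sx}{\kappa^2(s,3)\,n}+\frac{22\sigma^2x}{n}.$$ Furthermore, $$\mathbb{E}\|\hat\mu^Q-\mathbb{X}\beta^*\|^2\le\frac{(128+48\phi_{\max})\sigma^2s\log p}{\kappa^2(s,3)\,n}+\frac{384\sigma^2s}{\kappa^2(s,3)\,n}+\frac{90\sigma^2}{n}.$$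
   Context: Notation: $|\cdot|_2$ is the Euclidean norm, $|\beta|_1=\sum_j|\beta_j|$, $\|u\|^2=\frac1n|u|_2^2$ for $u\in\mathbb{R}^n$; for $\beta\in\mathbb{R}^p$, $\mathrm{supp}(\beta)=\{k:\beta_k\neq0\}$ and $|\beta|_0$ is the number of nonzero coefficients of $\beta$. Restricted Eigenvalue condition: for $s\in\{1,\dots,p\}$ and $c_0>0$, condition $RE(s,c_0)$ is satisfied if $$\kappa(s,c_0)=\min_{T\subset\{1,\dots,p\}:\,|T|\le s}\ \ \min_{\Delta\in\mathbb{R}^p:\ |\Delta_{T^c}|_1\le c_0|\Delta_T|_1}\ \frac{|\mathbb{X}\Delta|_2}{\sqrt n\,|\Delta_T|_2}>0,$$ where $\Delta_T$ is the restriction of $\Delta$ to the coordinates in $T$ and $T^c$ is the complement of $T$ (the ratio being considered for $\Delta_T\ne0$). Lasso: for a tuning parameter $\lambda$, $\hat\beta^L_\lambda$ is any minimizer over $\beta\in\mathbb{R}^p$ of $\frac1{2n}|y-\mathbb{X}\beta|_2^2+\lambda|\beta|_1$. Knots of the Lasso path: for a given observation $y$, there exist a positive integer $K$ and a finite sequence $\lambda_0>\lambda_1>\dots>\lambda_K=0$ (the knots) such that $\hat\beta^L_\lambda=0$ for all $\lambda>\lambda_0$, and such that $\mathrm{supp}(\hat\beta^L_\lambda)=\mathrm{supp}(\hat\beta^L_{\lambda_k})$ for all $\lambda\in(\lambda_{k+1},\lambda_k)$. These properties of the Lasso path are recalled in the paper as known. A support is a subset $T\subset\{1,\dots,p\}$;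 $|T|$ is its cardinality and $\Pi_T\in\mathbb{R}^{n\times n}$ is the orthogonal projection onto the linear span of the columns of $\mathbb{X}$ with indices in $T$. Weights: for every support $T$, $$\pi_T=\left(H_p\binom{p}{|T|}e^{|T|}\right)^{-1},\qquad H_p=\frac{e-e^{-p}}{e-1}.$$ Estimator $\hat\mu^Q$ (with noise level $\sigma^2$): let $\hat M$ be the cardinality of $\hat F$, write $\hat F=\{\hat T_1,\dots,\hat T_{\hat M}\}$, $\hat\mu_j=\Pi_{\hat T_j}y$, and $\hat\mu_\theta=\sum_{j=1}^{\hat M}\theta_j\hat\mu_j$ for $\theta\in\mathbb{R}^{\hat M}$. Let $\Lambda^{\hat M}=\{\theta\in\mathbb{R}^{\hat M}:\ \sum_j\theta_j=1,\ \theta_j\ge0\ \forall j\}$ and, for $\theta\in\Lambda^{\hat M}$, $$H(\theta)=|\hat\mu_\theta-y|_2^2+\frac12\sum_{j=1}^{\hat M}\theta_j|\hat\mu_j-\hat\mu_\theta|_2^2+26\sigma^2\sum_{j=1}^{\hat M}\theta_j\log\frac1{\pi_{\hat T_j}}.$$ Then $\hat\mu^Q=\hat\mu_{\hat\theta}$, where $\hat\theta$ is any minimizer of $H$ over $\Lambda^{\hat M}$.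
   Formalization: The knot property as stated (support on each open interval equals that at its upper knot) cannot hold when X^T y is nonzero; instead the support is constant on each interval and equals the support at some knot, so that F-hat is indeed the family of all supports on the path. *)

(* Defs.v *)
From HB Require Import structures.
From mathcomp Require Import all_boot all_order all_algebra.
From mathcomp Require Import all_classical all_reals all_analysis.

Set Implicit Arguments.
Unset Strict Implicit.
Unset Printing Implicit Defensive.

Import Order.TTheory GRing.Theory Num.Theory.
Local Open Scope classical_set_scope.
Local Open Scope ring_scope.

(* The library norm `|u| on matrices is the sup norm, hence these. *)
Definition l2norm (R : realType) (n : nat) (u : 'cV[R]_n) : R :=
  Num.sqrt (\sum_(i < n) u i 0 ^+ 2).

Definition l1norm (R : realType) (n : nat) (u : 'cV[R]_n) : R :=
  \sum_(i < n) `|u i 0|.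

Definition emp_sqnorm (R : realType) (n : nat) (u : 'cV[R]_n) : R :=
  n%:R^-1 * l2norm u ^+ 2.

Definition supp (R : realType) (p : nat) (b : 'cV[R]_p) : {set 'I_p} :=
  [set k | b k 0 != 0]%SET.

Definition l0norm (R : realType) (p : nat) (b : 'cV[R]_p) : nat := #|supp b|.

Definition restr (R : realType) (p : nat) (T : {set 'I_p}) (b : 'cV[R]_p) :
  'cV[R]_p := \col_k (if k \in T then b k 0 else 0).

(* The minimum over T of the minima over Delta is a single infimum over pairs;
   for 1 <= s <= p and c0 >= 0 it is attained and the set is nonempty. *)
Definition kappa (R : realType) (n p : nat) (X : 'M[R]_(n, p)) (s : nat)
    (c0 : R) : R :=
  inf [set r | exists (T : {set 'I_p}) (D : 'cV[R]_p),
    [/\ (#|T| <= s)%N,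
        l1norm (restr (~: T)%SET D) <= c0 * l1norm (restr T D),
        restr T D != 0
      & r = l2norm (X *m D) / (Num.sqrt n%:R * l2norm (restr T D))]].

Definition RE (R : realType) (n p : nat) (X : 'M[R]_(n, p)) (s : nat)
    (c0 : R) : Prop :=
  (1 <= s <= p)%N /\ 0 < kappa X s c0.

Definition is_largest_eigenvalue (R : realType) (p : nat) (A : 'M[R]_p)
    (a : R) : Prop :=
  eigenvalue A a /\ forall b : R, eigenvalue A b -> b <= a.

Definition lasso_objective (R : realType) (n p : nat) (X : 'M[R]_(n, p))
    (y : 'cV[R]_n) (l : R) (b : 'cV[R]_p) : R :=
  (2 * n%:R)^-1 * l2norm (y - X *m b) ^+ 2 + l * l1norm b.

Definition is_lasso (R : realType) (n p : nat) (X : 'M[R]_(n, p))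
    (y : 'cV[R]_n) (l : R) (b : 'cV[R]_p) : Prop :=
  forall b', lasso_objective X y l b <= lasso_objective X y l b'.

(* [bhat l] is the minimizer selected at tuning parameter [l].  On every open
   interval between consecutive knots the support is constant, and it is the
   support at some knot [lam j].  Always taking [j = k] would be unsatisfiable
   in general: at a value where the support changes by the entry of a variable,
   the coefficient of that variable still vanishes. *)
Definition is_lasso_knots (R : realType) (p : nat) (bhat : R -> 'cV[R]_p)
    (K : nat) (lam : nat -> R) : Prop :=
  [/\ (0 < K)%N,
      forall k, (k < K)%N -> lam k.+1 < lam k,
      lam K = 0,
      forall l : R, lam 0%N < l -> bhat l = 0
    & forall k, (k < K)%N -> exists2 j, (j <= K)%N &
        forall l : R, lam k.+1 < l < lam k -> supp (bhat l) = supp (bhat (lam j))].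

Definition path_supports (R : realType) (p : nat) (bhat : R -> 'cV[R]_p)
    (K : nat) (lam : nat -> R) : {set {set 'I_p}} :=
  [set supp (bhat (lam j)) | j : 'I_K.+1]%SET.

(* [X] with the columns outside [T] set to 0 *)
Definition restr_cols (R : realType) (n p : nat) (X : 'M[R]_(n, p))
    (T : {set 'I_p}) : 'M[R]_(n, p) :=
  \matrix_(i, k) (if k \in T then X i k else 0).

(* Orthogonal projection onto the column span of [X] restricted to [T]:
   [proj_mx] acts on row vectors, and the row kernel of a matrix is the
   orthogonal complement of its column span. *)
Definition proj_supp (R : realType) (n p : nat) (X : 'M[R]_(n, p))
    (T : {set 'I_p}) : 'M[R]_n :=
  (proj_mx <<(restr_cols X T)^T>>%MS (kermx (restr_cols X T)))^T.

Definition Hconst (R : realType) (p : nat) : R :=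
  (expR 1 - expR (- p%:R)) / (expR 1 - 1).

Definition supp_weight (R : realType) (p : nat) (T : {set 'I_p}) : R :=
  (Hconst R p * 'C(p, #|T|)%:R * expR #|T|%:R)^-1.

(* Weight vectors over the family [F] are indexed by the supports themselves;
   the values of [theta] outside [F] play no role. *)
Definition simplex (R : realType) (p : nat) (F : {set {set 'I_p}})
    (theta : {set 'I_p} -> R) : Prop :=
  \sum_(T in F) theta T = 1 /\ forall T, T \in F -> 0 <= theta T.

Definition mu_mix (R : realType) (n p : nat) (X : 'M[R]_(n, p))
    (y : 'cV[R]_n) (F : {set {set 'I_p}}) (theta : {set 'I_p} -> R) :
  'cV[R]_n := \sum_(T in F) theta T *: (proj_supp X T *m y).

Definition Q_objective (R : realType) (n p : nat) (X : 'M[R]_(n, p))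
    (sigma : R) (y : 'cV[R]_n) (F : {set {set 'I_p}})
    (theta : {set 'I_p} -> R) : R :=
  l2norm (mu_mix X y F theta - y) ^+ 2
  + 2^-1 * (\sum_(T in F)
      theta T * l2norm (proj_supp X T *m y - mu_mix X y F theta) ^+ 2)
  + 26 * sigma ^+ 2 * (\sum_(T in F) theta T * ln (supp_weight R T)^-1).

Definition is_Q_estimator (R : realType) (n p : nat) (X : 'M[R]_(n, p))
    (sigma : R) (y : 'cV[R]_n) (F : {set {set 'I_p}}) (m : 'cV[R]_n) : Prop :=
  exists theta : {set 'I_p} -> R,
    [/\ simplex F theta,
        forall theta', simplex F theta' ->
          Q_objective X sigma y F theta <= Q_objective X sigma y F theta'
      & m = mu_mix X y F theta].

Definition mutually_independent (d : measure_display) (Omega : measurableType d)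
    (R : realType) (P : probability Omega R) (n : nat)
    (X : 'I_n -> {RV P >-> R}) : Prop :=
  forall (J : {set 'I_n}) (B : 'I_n -> set R),
    (forall i, measurable (B i)) ->
    P [set w | forall i, i \in J -> B i (X i w)] =
    (\prod_(i in J) P (X i @^-1` B i))%E.

(* The law N(0, sigma^2 I_n); the second parameter of [normal_prob] is the
   standard deviation. *)
Definition is_gaussian_noise (d : measure_display) (Omega : measurableType d)
    (R : realType) (P : probability Omega R) (n : nat) (sigma : R)
    (xi : 'I_n -> {RV P >-> R}) : Prop :=
  (forall i (B : set R), measurable B ->
     distribution P (xi i) B = normal_prob 0 sigma B) /\
  mutually_independent xi.

Definition rvec (d : measure_display) (Omega : measurableType d)
    (R : realType) (P : probability Omega R) (n : nat)
    (X : 'I_n -> {RV P >-> R}) (w : Omega) : 'cV[R]_n := \col_i X i w.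

(* Main.v *)
Require Import Defs.
From HB Require Import structures.
From mathcomp Require Import all_boot all_order all_algebra.
From mathcomp Require Import all_classical all_reals all_analysis.
From mathcomp Require Import measurable_realfun ring lra.

(* Let [l] be the tuning level with [n l^2 = 36 phi sigma^2 log p] and [S] the
   support of the Lasso solution [b] at [l], which lies on the path.  Optimality
   of [b] and the restricted eigenvalue condition give
     |y - X b|^2 <= |xi|^2 + n l^2 s / kappa^2,
   while the KKT conditions [|X_k^T (y - X b)| >= n l] for [k] in [S] give
   [n l^2 |S| <= phi |Pi_S (y - X b)|^2].  By Pythagoras,
     36 sigma^2 |S| log p + |y - Pi_S y|^2
       <= |xi|^2 + 36 phi sigma^2 s log p / kappa^2,
   on every sample: no event controlling the noise is needed here.  Comparing
   the Q-aggregation criterion at its minimizer with its value at the vertex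
   [S], the term [36 sigma^2 |S| log p] absorbs the penalty of [S], and the only
   random term left is the supremum over all supports [T] of
     2 <xi, Pi_T y - mu> - |Pi_T y - mu|^2 / 4 - pen_T.
   The exponential moments of these variables are explicit for Gaussian noise,
   and the sum [Y] over [T] of their exponentials has mean at most 2.  Markov's
   inequality for [Y] gives the tail bound, [ln Y <= Y] the expectation bound. *)

Set Implicit Arguments.
Unset Strict Implicit.
Unset Printing Implicit Defensive.

Import Order.TTheory GRing.Theory Num.Theory.
Local Open Scope classical_set_scope.
Local Open Scope ring_scope.

Import HBNNSimple.

(** * Integration and independence *)

(** Simple functions and monotone convergence extend an identity known on sets to nonnegative
    functions. It serves with [f = id] and [G] a density, and with [f] one coordinate and [G] the
    product of the other factors. *)
Lemma ge0_integral_weight d d' (T : measurableType d) (T' : measurableType d')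
    (R : realType) (mu : {measure set T -> \bar R})
    (nu : {measure set T' -> \bar R}) (f : T -> T') (G : T -> R) (c : R)
    (h : T' -> \bar R) :
  measurable_fun setT f -> measurable_fun setT G -> (forall x, 0 <= G x) ->
  0 <= c ->
  (forall B, measurable B ->
     \int[mu]_(x in f @^-1` B) (G x)%:E = c%:E * nu B)%E ->
  measurable_fun setT h -> (forall x, 0 <= h x)%E ->
  (\int[mu]_x (h (f x) * (G x)%:E) = c%:E * \int[nu]_x h x)%E.
Proof.
move=> mf mG G0 c0 cG mh h0.
pose g := nnsfun_approx measurableT mh.
have gh x : h x = lim ((EFin \o g n) x @[n --> \oo]).
  by apply/esym/cvg_lim => //; exact: cvg_nnsfun_approx.
have mg n : measurable_fun setT (EFin \o g n) by exact/measurable_EFinP.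
have mgf n : measurable_fun setT (fun x => (g n (f x))%:E).
  by apply/measurable_EFinP/measurableT_comp.
have mGE : measurable_fun setT (EFin \o G) by exact/measurable_EFinP.
have -> : (\int[nu]_x h x = lim (\int[nu]_x (EFin \o g n) x @[n --> \oo]))%E.
  under eq_integral do rewrite gh.
  apply: monotone_convergence => //.
  - by move=> n x _ /=; rewrite lee_fin.
  - by move=> x _ a b ab; rewrite lee_fin; exact/lefP/nd_nnsfun_approx.
have -> : (\int[mu]_x (h (f x) * (G x)%:E) =
    lim (\int[mu]_x ((g n (f x))%:E * (G x)%:E) @[n --> \oo]))%E.
  have E x : (h (f x) * (G x)%:E = lim ((g n (f x))%:E * (G x)%:E @[n --> \oo]))%E.
    apply/esym/cvg_lim => //; apply: cvgeZr => //.
    exact: (@cvg_nnsfun_approx _ _ _ _ measurableT _ mh (fun x _ => h0 x) (f x)).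
  under eq_integral do rewrite E.
  apply: (@monotone_convergence _ _ _ mu setT measurableT
    (fun n x => (g n (f x))%:E * (G x)%:E)%E).
  - by move=> n; exact: emeasurable_funM.
  - by move=> n x _; rewrite mule_ge0 ?lee_fin.
  - move=> x _ a b ab; rewrite lee_wpmul2r ?lee_fin //.
    exact/lefP/nd_nnsfun_approx.
suff suf n : (\int[mu]_x ((g n (f x))%:E * (G x)%:E) =
    c%:E * \int[nu]_x (EFin \o g n) x)%E.
  under eq_fun do rewrite suf.
  apply/cvg_lim => //; apply: cvgeZl => //.
  apply/ereal_nondecreasing_is_cvgn => a b ab; apply: ge0_le_integral => //.
    by move=> x _; rewrite lee_fin.
  by move=> x _; rewrite lee_fin; exact/lefP/nd_nnsfun_approx.
transitivity (\int[mu]_x \sum_(y \in range (g n))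
    ((y * \1_(g n @^-1` [set y]) (f x))%:E * (G x)%:E))%E.
  apply: eq_integral => x _; rewrite (fimfunE (g n)) -ge0_mule_fsuml.
    by rewrite fsumEFin.
  by move=> y; exact: nnfun_muleindic_ge0.
have mi (y : R) : measurable_fun setT (fun x => (\1_(g n @^-1` [set y]) (f x) : R)).
  exact: measurableT_comp.
rewrite ge0_integral_fsum//; last 2 first.
- move=> y; apply: emeasurable_funM => //; apply/measurable_EFinP.
  exact: measurable_funM.
- by move=> y x _; rewrite mule_ge0 ?lee_fin// -lee_fin nnfun_muleindic_ge0.
transitivity (c%:E * \int[nu]_x
   (\sum_(y \in range (g n)) (y * \1_(g n @^-1` [set y]) x)%:E))%E; last first.
  by congr (_ * _)%E; apply: eq_integral => t tE; rewrite /= fimfunE -fsumEFin.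
rewrite ge0_integral_fsum//; last 2 first.
- by move=> y; apply/measurable_EFinP/measurable_funM.
- by move=> y x _; exact: nnfun_muleindic_ge0.
rewrite ge0_mule_fsumr; last first.
  by move=> y; apply: integral_ge0 => x _; exact: nnfun_muleindic_ge0.
apply: eq_fsbigr => y; rewrite inE => -[t _ yt].
have y0 : 0 <= y by rewrite -yt.
under [in RHS]eq_integral do rewrite EFinM.
rewrite integralZl_indic_nnsfun// integral_indic// setIT.
rewrite muleCA -cG//.
under eq_integral do rewrite EFinM -muleA.
rewrite ge0_integralZl//; last 2 first.
- by apply: emeasurable_funM => //; exact/measurable_EFinP.
- by move=> x _; rewrite mule_ge0 ?lee_fin.
congr (_ * _)%E; rewrite [RHS]integral_mkcond; apply: eq_integral => x _.
rewrite patchE indicE muleC /=; case: ifPn => [/set_mem|/negP] H.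
  by rewrite mem_set ?mule1.
by rewrite memNset ?mule0 // => K; apply: H; rewrite inE.
Qed.

Lemma expectation_normal d (T : measurableType d) (R : realType)
    (P : probability T R) (X : {RV P >-> R}) (m s : R) (h : R -> R) :
  (forall B, measurable B -> distribution P X B = normal_prob m s B) ->
  measurable_fun setT h -> (forall x, 0 <= h x) ->
  (\int[P]_w (h (X w))%:E =
   \int[lebesgue_measure]_x (h x * normal_pdf m s x)%:E)%E.
Proof.
move=> lawX mh h0.
have mhE : measurable_fun setT (EFin \o h) by exact/measurable_EFinP.
transitivity (\int[distribution P X]_x (h x)%:E)%E.
  by rewrite ge0_integral_distribution// => x; rewrite lee_fin.
have := @ge0_integral_weight _ _ (measurableTypeR R) R R lebesgue_measure
  (distribution P X) id (normal_pdf m s) 1 (EFin \o h).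
rewrite mul1e => <- //.
- exact: measurable_normal_pdf.
- by move=> x; exact: normal_pdf_ge0.
- by move=> B mB; rewrite mul1e; exact: (esym (lawX B mB)).
Qed.

(** Completing the square: the tilted density is a constant times the normal density with mean
    [s ^+ 2 * b]. *)
Lemma integral_expR_normal_pdf (R : realType) (s b : R) : 0 < s ->
  (\int[lebesgue_measure]_x (expR (b * x) * normal_pdf 0 s x)%:E =
   (expR (s ^+ 2 * b ^+ 2 / 2))%:E)%E.
Proof.
move=> s0; have sN0 : s != 0 by rewrite gt_eqF.
transitivity (\int[lebesgue_measure]_x
   ((expR (s ^+ 2 * b ^+ 2 / 2))%:E * (normal_pdf (s ^+ 2 * b) s x)%:E))%E.
  apply: eq_integral => x _; rewrite -EFinM; congr (_%:E).
  rewrite !normal_pdfE// mulrCA [RHS]mulrCA; congr (_ * _).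
  by rewrite /normal_fun -!expRD; congr expR; field.
rewrite ge0_integralZl//.
- by rewrite integral_normal_pdf mule1.
- by apply/measurable_EFinP; exact: measurable_normal_pdf.
- by move=> x _; rewrite lee_fin normal_pdf_ge0.
Qed.

(** The quadratic tilt only rescales: it yields [t^-1] times the centred normal density of standard
    deviation [t^-1]. *)
Lemma integral_expRX2_normal_pdf (R : realType) (a t : R) :
  0 < t -> 1 - 2 * a = t ^+ 2 ->
  (\int[lebesgue_measure]_x (expR (a * x ^+ 2) * normal_pdf 0 1 x)%:E =
   (t^-1)%:E)%E.
Proof.
move=> t0 tE; have tN0 : t != 0 by rewrite gt_eqF.
transitivity (\int[lebesgue_measure]_x
   ((t^-1)%:E * (normal_pdf 0 t^-1 x)%:E))%E.
  apply: eq_integral => x _; rewrite -EFinM; congr (_%:E).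
  rewrite !normal_pdfE ?oner_neq0 ?invr_eq0// mulrCA [RHS]mulrA; congr (_ * _).
    rewrite /normal_peak expr1n mul1r exprVn -mulrnAr.
    rewrite sqrtrM ?invr_ge0 ?exprn_ge0// 1?ltW// sqrtrV ?exprn_ge0// 1?ltW//.
    by rewrite sqrtr_sqr gtr0_norm// invfM invrK mulrA mulVf// mul1r.
  rewrite /normal_fun -!expRD; congr expR.
  have -> : a = (1 - t ^+ 2) / 2 by rewrite -tE; field.
  by field.
rewrite ge0_integralZl//.
- by rewrite integral_normal_pdf mule1.
- by apply/measurable_EFinP; exact: measurable_normal_pdf.
- by move=> x _; rewrite lee_fin normal_pdf_ge0.
- by rewrite lee_fin invr_ge0 ltW.
Qed.

(** Independence is given for events only. Indicators are replaced by general factors one at a time,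
    with the product of the other factors as weight in [ge0_integral_weight]. *)
Lemma expectation_prod_independent d (T : measurableType d) (R : realType)
    (P : probability T R) (n : nat) (X : 'I_n -> {RV P >-> R})
    (F : 'I_n -> R -> R) (m : 'I_n -> R) :
  mutually_independent X ->
  (forall i, measurable_fun setT (F i)) -> (forall i x, 0 <= F i x) ->
  (forall i, (\int[P]_w (F i (X i w))%:E = (m i)%:E)%E) ->
  (\int[P]_w (\prod_i F i (X i w))%:E = (\prod_i m i)%:E)%E.
Proof.
move=> indX mF F0 EF.
(* Only the factors with index at least [k] are required to be indicators: [k = n] is the claim,
   [k = 0] the definition of independence. *)
suff main k : (k <= n)%N -> forall (F : 'I_n -> R -> R) (m : 'I_n -> R),
    (forall i, measurable_fun setT (F i)) -> (forall i x, 0 <= F i x) ->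
    (forall i, (\int[P]_w (F i (X i w))%:E = (m i)%:E)%E) ->
    (forall i : 'I_n, (k <= i)%N ->
       exists2 B, measurable B & F i = \1_B) ->
    (\int[P]_w (\prod_i F i (X i w))%:E = (\prod_i m i)%:E)%E.
  apply: (main n) => // i; rewrite leqNgt ltn_ord; done.
elim: k => [_|k IH kn] {mF F0 EF}F {}m mF F0 EF FB.
  have {FB} /choice[B FB] : forall i : 'I_n,
      exists B, measurable B /\ F i = \1_B.
    by move=> i; have [//|B mB FiE] := FB i; exists B.
  have mB i : measurable (B i) by case: (FB i).
  have FE i : F i = \1_(B i) by case: (FB i).
  have mE (i : 'I_n) : P (X i @^-1` B i) = (m i)%:E.
    rewrite -EF -(setIT (_ @^-1` _)) -integral_indic//; last first.
      exact: measurable_funPTI.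
    by apply: eq_integral => w _; rewrite FE.
  have -> : (\prod_i m i)%:E = (\prod_(i in [set: 'I_n]%SET) P (X i @^-1` B i))%E.
    by rewrite -prodEFin; apply: eq_big => [i|i _]; rewrite ?inE ?mE.
  rewrite -indX// -[in RHS](setIT [set w | _]) -integral_indic//; last first.
    have -> : [set w | forall i, i \in [set: 'I_n]%SET -> B i (X i w)] =
        \bigcap_(i in [set: 'I_n]) (X i @^-1` B i).
      apply/seteqP; split => w /= H i; first by move=> _; apply: H; rewrite inE.
      by move=> _; exact: H.
    by apply: fin_bigcap_measurable => // i _; exact: measurable_funPTI.
  apply: eq_integral => w _; congr (_%:E).
  under eq_bigr do rewrite FE indicE.
  rewrite indicE; have [H|/existsNP[i Bi]] :=
      pselect (forall i, B i (X i w)).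
    by rewrite big1 ?mem_set// => i _; rewrite mem_set.
  rewrite (bigD1 i)//= memNset// mul0r memNset// => H; apply: Bi.
  by apply: H; rewrite inE.
pose k0 := Ordinal kn.
rewrite (bigD1 k0)//= mulrC EFinM.
transitivity (\int[P]_w ((F k0 (X k0 w))%:E *
   (\prod_(i < n | i != k0) F i (X i w))%:E))%E.
  by apply: eq_integral => w _; rewrite (bigD1 k0).
rewrite (@ge0_integral_weight _ _ _ _ _ P (distribution P (X k0)) (X k0)
  (fun w => \prod_(i < n | i != k0) F i (X i w))
  (\prod_(i < n | i != k0) m i) (EFin \o F k0))//.
- congr (_ * _)%E; rewrite -EF ge0_integral_distribution//.
    by apply/measurable_EFinP.
  by move=> x; rewrite lee_fin.
- under eq_fun do rewrite -big_filter.
  by apply: measurable_prod => i _; exact: measurableT_comp.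
- by move=> w; exact: prodr_ge0.
- apply: prodr_ge0 => i _; rewrite -lee_fin -EF.
  by apply: integral_ge0 => w _; rewrite lee_fin.
- move=> B mB.
  (* On a set [B] the weight identity is the induction hypothesis, with the factor at [k0] replaced
     by the indicator of [B]. *)
  pose F' i := if i == k0 then \1_B else F i.
  pose m' i := if i == k0 then fine (P (X k0 @^-1` B)) else m i.
  have := IH (ltnW kn) F' m'.
  rewrite (bigD1 k0)//= /m' eqxx mulrC EFinM fineK ?fin_num_measure//; last first.
    exact: measurable_funPTI.
  rewrite (eq_bigr m) => [|i /negPf ->//] <-.
  + rewrite integral_mkcond; apply: eq_integral => w _.
    rewrite patchE [in RHS](bigD1 k0)//= {1}/F' eqxx indicE.
    rewrite [X in _ = (_ * X)%:E](eq_bigr (fun i => F i (X i w))); last first.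
      by move=> i /negPf ik; rewrite /F' ik.
    case: ifPn => [/set_mem|/negP] H; first by rewrite mem_set// mul1r.
    by rewrite memNset ?mul0r// => K; apply: H; rewrite inE.
  + by move=> i; rewrite /F'; case: ifPn => // _; exact: measurable_indic.
  + by move=> i x; rewrite /F'; case: ifPn.
  + move=> i; rewrite /F' /m'; case: ifPn => [/eqP ->|_]; last exact: EF.
    rewrite fineK ?fin_num_measure//; last exact: measurable_funPTI.
    rewrite -[in RHS](setIT (_ @^-1` _)) -integral_indic//.
    exact: measurable_funPTI.
  + move=> i ki; rewrite /F'; case: ifPn => [_|ik]; first by exists B.
    apply: FB; rewrite ltn_neqAle ki andbT; apply: contraNneq ik => ki'.
    by apply/eqP/val_inj.
- by apply/measurable_EFinP.
- by move=> x; rewrite lee_fin.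
Qed.

(** * Euclidean geometry *)

Definition dotv (R : realType) (n : nat) (u v : 'cV[R]_n) : R :=
  \sum_i u i 0 * v i 0.

Lemma dotvC (R : realType) n (u v : 'cV[R]_n) : dotv u v = dotv v u.
Proof. by apply: eq_bigr => i _; rewrite mulrC. Qed.

Lemma dotvDl (R : realType) n (u v w : 'cV[R]_n) :
  dotv (u + v) w = dotv u w + dotv v w.
Proof. by rewrite -big_split; apply: eq_bigr => i _; rewrite mxE mulrDl. Qed.

Lemma dotvZl (R : realType) n (a : R) (u v : 'cV[R]_n) :
  dotv (a *: u) v = a * dotv u v.
Proof. by rewrite mulr_sumr; apply: eq_bigr => i _; rewrite mxE mulrA. Qed.

Lemma dotvNl (R : realType) n (u v : 'cV[R]_n) : dotv (- u) v = - dotv u v.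
Proof. by rewrite -scaleN1r dotvZl mulN1r. Qed.

Lemma dotvBl (R : realType) n (u v w : 'cV[R]_n) :
  dotv (u - v) w = dotv u w - dotv v w.
Proof. by rewrite dotvDl dotvNl. Qed.

Lemma dotvDr (R : realType) n (u v w : 'cV[R]_n) :
  dotv w (u + v) = dotv w u + dotv w v.
Proof. by rewrite dotvC dotvDl !(dotvC w). Qed.

Lemma dotvZr (R : realType) n (a : R) (u v : 'cV[R]_n) :
  dotv u (a *: v) = a * dotv u v.
Proof. by rewrite dotvC dotvZl dotvC. Qed.

Lemma dotvNr (R : realType) n (u v : 'cV[R]_n) : dotv u (- v) = - dotv u v.
Proof. by rewrite dotvC dotvNl dotvC. Qed.

Lemma dotvBr (R : realType) n (u v w : 'cV[R]_n) :
  dotv w (u - v) = dotv w u - dotv w v.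
Proof. by rewrite dotvDr dotvNr. Qed.

Lemma dotv0 (R : realType) n (u : 'cV[R]_n) : dotv u 0 = 0.
Proof. by apply: big1 => i _; rewrite mxE mulr0. Qed.

Lemma dotv_sumr (R : realType) n I (r : seq I) (Q : pred I)
    (F : I -> 'cV[R]_n) (u : 'cV[R]_n) :
  dotv u (\sum_(i <- r | Q i) F i) = \sum_(i <- r | Q i) dotv u (F i).
Proof.
exact: (big_morph (dotv u) (fun v w => dotvDr v w u) (dotv0 u)).
Qed.

Lemma dotv_ge0 (R : realType) n (u : 'cV[R]_n) : 0 <= dotv u u.
Proof. by apply: sumr_ge0 => i _; rewrite -expr2 sqr_ge0. Qed.

Lemma dotv_eq0 (R : realType) n (u : 'cV[R]_n) : (dotv u u == 0) = (u == 0).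
Proof.
apply/eqP/eqP => [/eqP|->]; last exact: dotv0.
rewrite psumr_eq0 => [/allP u0|i _]; last by rewrite -expr2 sqr_ge0.
apply/matrixP => i j; rewrite ord1 mxE; apply/eqP.
by have := u0 i (mem_index_enum _); rewrite -expr2 sqrf_eq0.
Qed.

Lemma dotv_mulmx (R : realType) n p (A : 'M[R]_(n, p)) (b : 'cV[R]_p)
    (u : 'cV[R]_n) : dotv u (A *m b) = dotv (A^T *m u) b.
Proof.
rewrite /dotv; under eq_bigr do rewrite mxE mulr_sumr.
rewrite exchange_big; apply: eq_bigr => j _.
rewrite mxE mulr_suml; apply: eq_bigr => i _.
by rewrite !mxE mulrCA mulrA.
Qed.

Lemma l2norm_sqr (R : realType) n (u : 'cV[R]_n) : l2norm u ^+ 2 = dotv u u.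
Proof.
rewrite sqr_sqrtr; last by apply: sumr_ge0 => i _; exact: sqr_ge0.
by apply: eq_bigr => i _; rewrite expr2.
Qed.

(** Recursive on the list, so that Gram-Schmidt and the moment computation can both split off one
    vector at a time. *)
Fixpoint orthonormal (R : realType) n (us : seq 'cV[R]_n) : Prop :=
  if us is u :: us' then
    [/\ dotv u u = 1, (forall v, v \in us' -> dotv u v = 0) & orthonormal us']
  else True.

(** * Gaussian exponential moments *)

Section gaussian_mgf.
Context d (T : measurableType d) (R : realType) (P : probability T R) (n : nat)
  (sigma : R) (xi : 'I_n -> {RV P >-> R}).
Hypotheses (sigma_gt0 : 0 < sigma) (xi_gauss : is_gaussian_noise sigma xi).

Lemma measurable_dotv_rvec (c : 'cV[R]_n) :
  measurable_fun setT (fun w => dotv c (rvec xi w)).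
Proof.
rewrite /dotv; under eq_fun do under eq_bigr do rewrite mxE.
by apply: measurable_sum => i; exact: measurable_funM.
Qed.

Lemma measurable_quadratic (a : R) (us : seq 'cV[R]_n) (c : 'cV[R]_n) :
  measurable_fun setT (fun w =>
    expR (a * \sum_(u <- us) dotv u (rvec xi w) ^+ 2 + dotv c (rvec xi w))).
Proof.
apply: measurableT_comp => //; apply: measurable_funD.
  apply: measurable_funM => //; apply: measurable_sum => u.
  by apply: measurable_funX; exact: measurable_dotv_rvec.
exact: measurable_dotv_rvec.
Qed.

Lemma gaussian_linear_mgf (c : 'cV[R]_n) :
  (\int[P]_w (expR (dotv c (rvec xi w)))%:E =
   (expR (sigma ^+ 2 * dotv c c / 2))%:E)%E.
Proof.
have [law ind] := xi_gauss.
transitivity (\int[P]_w (\prod_i expR (c i 0 * xi i w))%:E)%E.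
  apply: eq_integral => w _; rewrite expR_sum; congr (_%:E).
  by apply: eq_bigr => i _; rewrite mxE.
rewrite (@expectation_prod_independent _ _ _ _ _ xi
  (fun i x => expR (c i 0 * x)) (fun i => expR (sigma ^+ 2 * c i 0 ^+ 2 / 2)))//.
- rewrite -expR_sum /dotv; congr (expR _)%:E.
  by rewrite mulr_sumr mulr_suml; under eq_bigr do rewrite expr2.
- by move=> i; apply: measurableT_comp => //; exact: measurable_funM.
- move=> i; have := @expectation_normal _ _ _ P (xi i) 0 sigma
    (fun x => expR (c i 0 * x)) (law i).
  move=> ->; first exact: integral_expR_normal_pdf.
    by apply: measurableT_comp => //; exact: measurable_funM.
  by move=> x; exact: expR_ge0.
Qed.

(* Gaussian linearization: exp(a u^2) is the mean of exp(sqrt(2a) g u) for a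
   standard normal g, which reduces one square to the linear case. *)
Lemma gaussian_quadratic_mgf (a t : R) (us : seq 'cV[R]_n) (c : 'cV[R]_n) :
  0 <= a -> 0 < t -> 1 - 2 * (a * sigma ^+ 2) = t ^+ 2 ->
  orthonormal us -> (forall u, u \in us -> dotv u c = 0) ->
  (\int[P]_w (expR (a * \sum_(u <- us) dotv u (rvec xi w) ^+ 2
                    + dotv c (rvec xi w)))%:E =
   (t^-1 ^+ size us * expR (sigma ^+ 2 * dotv c c / 2))%:E)%E.
Proof.
move=> a0 t0 tE; elim: us c => [|u us IH] c /=.
  move=> _ _; rewrite mul1r -gaussian_linear_mgf.
  by under eq_integral do rewrite big_nil mulr0 add0r.
move=> [uu uus ous] uc.
have uc0 : dotv u c = 0 by apply: uc; rewrite mem_head.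
(* Integrating out the second coordinate [g] first restores the square of [dotv u]; integrating over
   the sample first leaves one square fewer. *)
pose F (z : T * measurableTypeR R) :=
  (expR (a * \sum_(u <- us) dotv u (rvec xi z.1) ^+ 2 + dotv c (rvec xi z.1)
    + Num.sqrt (2 * a) * dotv u (rvec xi z.1) * z.2)
   * normal_pdf 0 1 z.2)%:E.
transitivity (\int[P]_w \int[lebesgue_measure]_g F (w, g))%E.
  apply: eq_integral => w _; rewrite /F /=.
  under eq_integral do rewrite expRD -mulrA EFinM.
  rewrite ge0_integralZl//; first last.
  - by move=> g _; rewrite lee_fin mulr_ge0 ?expR_ge0 ?normal_pdf_ge0.
  - apply/measurable_EFinP; apply: measurable_funM.
      by apply: measurableT_comp => //; exact: measurable_funM.
    exact: measurable_normal_pdf.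
  rewrite integral_expR_normal_pdf// -EFinM -expRD; congr (expR _)%:E.
  rewrite exprMn sqr_sqrtr ?mulr_ge0// big_cons expr1n mul1r.
  by field.
rewrite fubini_tonelli; first last.
- by move=> z; rewrite lee_fin mulr_ge0 ?expR_ge0 ?normal_pdf_ge0.
- apply/measurable_EFinP; apply: measurable_funM.
    apply: measurableT_comp => //; apply: measurable_funD.
      apply: measurable_funD; last first.
        exact: (measurableT_comp (measurable_dotv_rvec c)).
      apply: measurable_funM => //; apply: measurable_sum => v.
      apply: measurable_funX.
      exact: (measurableT_comp (measurable_dotv_rvec v)).
    apply: measurable_funM => //; apply: measurable_funM => //.
    exact: (measurableT_comp (measurable_dotv_rvec u)).
  exact: measurableT_comp (measurable_normal_pdf _ _) _.
transitivity (\int[lebesgue_measure]_g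
   ((t^-1 ^+ size us * expR (sigma ^+ 2 * dotv c c / 2))%:E *
    (expR (a * sigma ^+ 2 * g ^+ 2) * normal_pdf 0 1 g)%:E))%E.
  apply: eq_integral => g _; rewrite /F /=.
  (* [c'] stays orthogonal to the remaining vectors and, since [dotv u c = 0], its squared norm
     exceeds that of [c] by [2 a g^2]. *)
  pose c' := c + (Num.sqrt (2 * a) * g) *: u.
  transitivity (\int[P]_w ((normal_pdf 0 1 g)%:E *
    (expR (a * \sum_(u <- us) dotv u (rvec xi w) ^+ 2
                    + dotv c' (rvec xi w)))%:E))%E.
    apply: eq_integral => w _; rewrite -EFinM mulrC; congr (_ * expR _)%:E.
    by rewrite /c' dotvDl dotvZl; ring.
  rewrite ge0_integralZl//; first last.
  - by rewrite lee_fin normal_pdf_ge0.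
  - exact/measurable_EFinP/measurable_quadratic.
  rewrite IH//; last first.
    move=> v vus; rewrite /c' dotvDr dotvZr uc ?inE ?vus ?orbT//.
    by rewrite dotvC uus// mulr0 addr0.
  have -> : sigma ^+ 2 * dotv c' c' / 2 =
      sigma ^+ 2 * dotv c c / 2 + a * sigma ^+ 2 * g ^+ 2.
    rewrite /c' !(dotvDl, dotvDr, dotvZl, dotvZr) uu (dotvC c) uc0.
    rewrite !mulr0 add0r addr0 mulr1 -expr2 exprMn sqr_sqrtr ?mulr_ge0//.
    by field.
  by rewrite expRD -!EFinM; congr (_%:E); ring.
rewrite ge0_integralZl//; first last.
- by rewrite lee_fin mulr_ge0 ?expR_ge0// exprn_ge0// invr_ge0 ltW.
- by move=> g _; rewrite lee_fin mulr_ge0 ?expR_ge0 ?normal_pdf_ge0.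
- apply/measurable_EFinP; apply: measurable_funM; last first.
    exact: measurable_normal_pdf.
  apply: measurableT_comp => //; apply: measurable_funM => //.
rewrite (integral_expRX2_normal_pdf t0 tE) -EFinM; congr (_%:E).
by rewrite mulrAC -exprSr.
Qed.

End gaussian_mgf.

(** * Orthonormal bases and projections *)

Lemma dotv_orthonormal_sum (R : realType) n (us : seq 'cV[R]_n)
    (c : 'cV[R]_n -> R) : orthonormal us ->
  forall u, u \in us -> dotv u (\sum_(v <- us) c v *: v) = c u.
Proof.
elim: us => [//|a us IH] [aa aus ous] u; rewrite inE big_cons dotvDr dotvZr.
have [-> _|_ /= uus] := eqVneq u a.
  rewrite aa mulr1 dotv_sumr big_seq big1 ?addr0// => v vus.
  by rewrite dotvZr aus// mulr0.
by rewrite IH// dotvC aus// mulr0 add0r.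
Qed.

(** The last clause says in dual form that the new vectors lie in the span of the old ones; it
    passes orthogonality on to the basis. *)
Lemma gram_schmidt (R : realType) n (vs : seq 'cV[R]_n) :
  exists us : seq 'cV[R]_n,
    [/\ orthonormal us, (size us <= size vs)%N,
        forall v, v \in vs -> v = \sum_(u <- us) dotv u v *: u
      & forall z, (forall v, v \in vs -> dotv v z = 0) ->
          forall u, u \in us -> dotv u z = 0].
Proof.
elim: vs => [|v vs [us [ous sus span ort]]]; first by exists [::].
pose r := v - \sum_(u <- us) dotv u v *: u.
have ur u : u \in us -> dotv u r = 0.
  by move=> uus; rewrite dotvBr (dotv_orthonormal_sum (fun x => dotv x v))// subrr.
have rz z : (forall x, x \in v :: vs -> dotv x z = 0) -> dotv r z = 0.
  move=> vz; rewrite dotvBl vz ?mem_head// dotvC dotv_sumr big_seq big1 ?subrr//.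
  move=> u uus; rewrite dotvZr (dotvC z) (ort z) ?mulr0// => x xvs.
  by apply: vz; rewrite inE xvs orbT.
have [r0|r0] := eqVneq r 0.
  exists us; split => //; first exact: leqW.
    move=> x; rewrite inE => /orP[/eqP ->|]; last exact: span.
    by apply/eqP; rewrite -subr_eq0; apply/eqP.
  by move=> z vz; apply: ort => x xvs; apply: vz; rewrite inE xvs orbT.
have rr0 : 0 < dotv r r by rewrite lt_def dotv_eq0 r0 dotv_ge0.
pose k := (Num.sqrt (dotv r r))^-1.
have kk : k * k * dotv r r = 1.
  by rewrite -invfM -expr2 sqr_sqrtr ?dotv_ge0// mulVf// gt_eqF.
have krr : k *: r \notin us.
  apply/negP => /ur; rewrite dotvZl => /eqP; rewrite mulf_eq0 dotv_eq0 (negPf r0).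
  by rewrite orbF invr_eq0 sqrtr_eq0 leNgt rr0.
exists (k *: r :: us); split => /=.
- split => //; first by rewrite dotvZl dotvZr mulrA.
  by move=> u uus; rewrite dotvZl (dotvC r) ur// mulr0.
- by rewrite ltnS.
- move=> x; rewrite inE big_cons => /orP[/eqP ->|xvs].
    rewrite scalerA dotvZl.
    have -> : dotv r v = dotv r r.
      rewrite {3}/r dotvBr dotv_sumr big_seq big1 ?subr0// => u uus.
      by rewrite dotvZr (dotvC r) ur// mulr0.
    by rewrite mulrAC kk scale1r subrK.
  have rx : dotv r x = 0.
    rewrite (span x xvs) dotv_sumr big_seq big1// => u uus.
    by rewrite dotvZr (dotvC r) ur// mulr0.
  by rewrite dotvZl rx mulr0 scale0r add0r; exact: span.
- move=> z vz u; rewrite inE => /orP[/eqP ->|uus].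
    by rewrite dotvZl rz// mulr0.
  by apply: (ort z) => // x xvs; apply: vz; rewrite inE xvs orbT.
Qed.

Section projection.
Context (R : realType) (n p : nat) (X : 'M[R]_(n, p)) (T : {set 'I_p}).
Let A := restr_cols X T.

(** If [W = D A^T] and [W A = 0], then [W W^T = W A D^T = 0], so every row of [W] has norm zero.
    This makes [proj_mx] a projection along a complement. *)
Lemma cap_row_ker (U := <<A^T>>%MS) : (U :&: kermx A = 0)%MS.
Proof.
set W := (_ :&: _)%MS.
have : (W <= U :&: kermx A)%MS by [].
rewrite sub_capmx genmxE => /andP[/submxP[D WD] /sub_kermxP WA].
have WW : W *m W^T = 0 by rewrite {2}WD trmx_mul trmxK mulmxA WA mul0mx.
apply/row_matrixP => i; rewrite row0; apply: trmx_inj; rewrite trmx0.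
apply/eqP; rewrite -dotv_eq0; apply/eqP.
transitivity ((W *m W^T) i i); last by rewrite WW mxE.
by rewrite mxE; apply: eq_bigr => j _; rewrite !mxE.
Qed.

Lemma proj_supp_sub (v : 'cV[R]_n) : exists a, proj_supp X T *m v = A *m a.
Proof.
have : (v^T *m proj_mx <<A^T>> (kermx A) <= A^T)%MS.
  by rewrite (submx_trans (proj_mx_sub _ _ _))// genmxE.
move=> /submxP[D vD]; exists D^T.
by apply: trmx_inj; rewrite !trmx_mul trmxK vD trmxK.
Qed.

(** By rank-nullity the row space of [A^T] and the kernel of [A], which meet trivially, fill the
    whole space, so the residual lies in the kernel. *)
Lemma proj_supp_compl (v : 'cV[R]_n) : A^T *m (v - proj_supp X T *m v) = 0.
Proof.
have full : (1%:M <= <<A^T>> + kermx A)%MS.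
  rewrite sub1mx /row_full mxrank_disjoint_sum ?cap_row_ker//.
  by rewrite genmxE mxrank_tr mxrank_ker subnKC ?rank_leq_row.
have /sub_kermxP : (v^T - v^T *m proj_mx <<A^T>> (kermx A) <= kermx A)%MS.
  by apply: proj_mx_compl_sub; apply: submx_trans full; exact: submx1.
move=> vA; apply: trmx_inj; rewrite trmx_mul trmxK trmx0 -[RHS]vA.
by rewrite linearB /= trmx_mul trmxK.
Qed.

Lemma restr_cols_mul (a : 'cV[R]_p) : A *m a = \sum_(k in T) a k 0 *: col k X.
Proof.
apply/matrixP => i j; rewrite ord1 !mxE summxE [RHS]big_mkcond.
by apply: eq_bigr => k _; rewrite !mxE; case: ifP => _; rewrite ?mul0r// mulrC.
Qed.

Lemma proj_supp_orth (v : 'cV[R]_n) (k : 'I_p) : k \in T ->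
  dotv (col k X) (v - proj_supp X T *m v) = 0.
Proof.
move=> kT; have /matrixP/(_ k 0) := proj_supp_compl v; rewrite !mxE => <-.
by apply: eq_bigr => i _; rewrite !mxE kT.
Qed.

(** Orthonormalize the columns in [T]: the residual is orthogonal to these columns, hence to the
    basis, so [v] and its projection have the same coefficients. *)
Lemma proj_supp_orthonormal : exists us : seq 'cV[R]_n,
  [/\ orthonormal us, (size us <= #|T|)%N
    & forall v, proj_supp X T *m v = \sum_(u <- us) dotv u v *: u].
Proof.
have [us [ous sus span ort]] := gram_schmidt [seq col k X | k <- enum T].
exists us; split => //; first by rewrite size_map -cardE in sus.
move=> v; have [a Pa] := proj_supp_sub v.
have uv u : u \in us -> dotv u v = dotv u (proj_supp X T *m v).
  move=> uus; apply/eqP; rewrite -subr_eq0 -dotvBr; apply/eqP.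
  apply: (ort (v - proj_supp X T *m v) _ u uus) => x.
  by case/mapP=> k; rewrite mem_enum => kT ->; exact: proj_supp_orth.
transitivity (\sum_(u <- us) dotv u (proj_supp X T *m v) *: u); last first.
  by rewrite !big_seq; apply: eq_bigr => u /uv ->.
rewrite Pa restr_cols_mul.
under [RHS]eq_bigr => u _ do rewrite dotv_sumr scaler_suml.
rewrite exchange_big /=; apply: eq_bigr => k kT.
rewrite {1}(span (col k X)); last first.
  by apply/mapP; exists k => //; rewrite mem_enum.
by rewrite scaler_sumr; apply: eq_bigr => u _; rewrite dotvZr scalerA.
Qed.

End projection.

(** * Cauchy-Schwarz, operator bounds and the Rayleigh quotient *)

Lemma discr_le0 (R : realFieldType) (a b c : R) :
  0 <= c -> (forall t, 0 <= a + 2 * b * t + c * t ^+ 2) -> b ^+ 2 <= a * c.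
Proof.
move=> c_ge0 H.
have [c0|c0] := eqVneq c 0.
  rewrite c0 mulr0; have [->|b0] := eqVneq b 0; first by rewrite expr0n.
  have := H (- (a + 1) / (2 * b)); rewrite c0 mul0r addr0.
  have -> : a + 2 * b * (- (a + 1) / (2 * b)) = -1 by field; rewrite b0.
  by rewrite oppr_ge0 ler10.
have c_gt0 : 0 < c by rewrite lt_def c0.
have := H (- b / c).
have -> : a + 2 * b * (- b / c) + c * (- b / c) ^+ 2 = (a * c - b ^+ 2) / c.
  by field.
by rewrite pmulr_lge0 ?invr_gt0// subr_ge0.
Qed.

Lemma dotv_cauchy_schwarz (R : realType) n (u v : 'cV[R]_n) :
  dotv u v ^+ 2 <= dotv u u * dotv v v.
Proof.
apply: discr_le0 => [|t]; first exact: dotv_ge0.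
have := dotv_ge0 (u + t *: v); rewrite !(dotvDl, dotvDr, dotvZl, dotvZr) (dotvC v u).
by move=> h; rewrite (le_trans h)// le_eqVlt; apply/orP; left; apply/eqP; ring.
Qed.

(** [C] is the squared Frobenius norm, plus one to make it positive. *)
Lemma dotv_mulmx_bound (R : realType) p (B : 'M[R]_p) :
  exists2 C, 0 < C &
    forall x : 'cV[R]_p, dotv (B *m x) (B *m x) <= C * dotv x x.
Proof.
exists (1 + \sum_i \sum_j B i j ^+ 2) => [|x].
  rewrite ltr_pwDl// sumr_ge0// => i _; rewrite sumr_ge0// => j _.
  exact: sqr_ge0.
apply: (@le_trans _ _ ((\sum_i \sum_j B i j ^+ 2) * dotv x x)); last first.
  by rewrite ler_wpM2r ?dotv_ge0// lerDr.
rewrite mulr_suml; apply: ler_sum => i _; rewrite -expr2.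
pose b := \col_j B i j.
have -> : (B *m x) i 0 = dotv b x.
  by rewrite mxE; apply: eq_bigr => j _; rewrite mxE.
have -> : \sum_j B i j ^+ 2 = dotv b b.
  by apply: eq_bigr => j _; rewrite mxE expr2.
exact: dotv_cauchy_schwarz.
Qed.

Lemma dotv_mulmx_le (R : realType) p (B : 'M[R]_p) :
  exists2 C, 0 < C & forall x : 'cV[R]_p, dotv x (B *m x) <= C * dotv x x.
Proof.
have [C C0 CB] := dotv_mulmx_bound B.
exists (1 + C) => [|x]; first by rewrite ltr_pwDl// ltW.
have := dotv_ge0 (x - B *m x).
rewrite !(dotvBl, dotvBr) (dotvC (B *m x)) => h.
have := CB x; have := dotv_ge0 x; have := dotv_ge0 (B *m x); lra.
Qed.

(* With [M] the supremum of the Rayleigh quotient, [M - A] is positive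
   semidefinite; were it invertible, it would dominate a multiple of the
   identity and [M] could be lowered. *)
Lemma rayleigh_le (R : realType) p (A : 'M[R]_p) (phi : R) :
  A^T = A -> (forall b, eigenvalue A b -> b <= phi) ->
  forall x : 'cV[R]_p, dotv x (A *m x) <= phi * dotv x x.
Proof.
move=> At phi_ge x0.
have [->|x0N0] := eqVneq x0 0; first by rewrite ?mulmx0 !dotv0 mulr0.
pose S := [set r | exists x : 'cV[R]_p, 0 < dotv x x /\
  r = dotv x (A *m x) / dotv x x].
have dgt0 (x : 'cV[R]_p) : x != 0 -> 0 < dotv x x.
  by move=> xN0; rewrite lt_def dotv_eq0 xN0 dotv_ge0.
have supS : has_sup S.
  split.
    by exists (dotv x0 (A *m x0) / dotv x0 x0); exists x0; rewrite dgt0.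
  have [C _ CA] := dotv_mulmx_le A.
  by exists C => _ [x [xx ->]]; rewrite ler_pdivrMr.
pose M := sup S; pose B := M%:M - A.
have Bx x : B *m x = M *: x - A *m x by rewrite mulmxBl mul_scalar_mx.
have leM (x : 'cV[R]_p) : dotv x (A *m x) <= M * dotv x x.
  have [->|/dgt0 xx] := eqVneq x 0; first by rewrite ?mulmx0 !dotv0 mulr0.
  by rewrite -ler_pdivrMr//; apply: sup_upper_bound => //; exists x.
have Bpsd x : 0 <= dotv x (B *m x).
  by rewrite Bx dotvBr dotvZr subr_ge0.
have Bsym x z : dotv x (B *m z) = dotv z (B *m x).
  by rewrite dotv_mulmx dotvC /B linearB /= At tr_scalar_mx.
have Bcs x z : dotv x (B *m z) ^+ 2 <= dotv x (B *m x) * dotv z (B *m z).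
  apply: discr_le0 => // t; have := Bpsd (x + t *: z).
  rewrite mulmxDr -scalemxAr !(dotvDl, dotvDr, dotvZl, dotvZr) (Bsym z x) => h.
  by rewrite (le_trans h)// le_eqVlt; apply/orP; left; apply/eqP; ring.
suff : eigenvalue A M.
  by move=> /phi_ge Mphi; rewrite (le_trans (leM _))// ler_wpM2r ?dotv_ge0.
have [uB|] := boolP (B \in unitmx); last first.
  rewrite -row_free_unit -kermx_eq0 => /rowV0Pn[v /sub_kermxP vB v0].
  apply/eigenvalueP; exists v => //; apply/esym/eqP; rewrite -subr_eq0.
  by rewrite -vB mulmxBr mul_mx_scalar.
have [C C0 CB] := dotv_mulmx_le B.
have [D D0 DB] := dotv_mulmx_bound (invmx B).
(* Coercivity: [|x|^2 <= D |B x|^2], while [Bcs] at [B x] and [x] gives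
   [|B x|^4 <= C |B x|^2 dotv x (B *m x)]. *)
have low x : dotv x x <= D * C * dotv x (B *m x).
  have [->|xN0] := eqVneq x 0; first by rewrite ?mulmx0 !dotv0 mulr0.
  have BxN0 : B *m x != 0.
    by apply: contraNneq xN0 => Bx0; rewrite -(mulKmx uB x) Bx0 mulmx0.
  have bb := dgt0 _ BxN0.
  have := DB (B *m x); rewrite mulKmx// => /le_trans; apply.
  rewrite -mulrA ler_pM2l// -(ler_pM2r bb).
  have := Bcs (B *m x) x; rewrite expr2 => /le_trans; apply.
  rewrite mulrAC ler_wpM2r//; exact: CB.
(* By [low] every Rayleigh quotient is at most [M - (D * C)^-1], against the choice of [M] as their
   supremum. *)
have eps0 : 0 < (D * C)^-1 by rewrite invr_gt0 mulr_gt0.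
have [_ [x [xx ->]]] := sup_adherent eps0 supS.
rewrite ltNge => /negP[]; rewrite ler_pdivrMr// -/M.
have := low x; rewrite -(ler_pM2l eps0) mulKf ?gt_eqF ?mulr_gt0//.
rewrite Bx dotvBr dotvZr mulrBl; lra.
Qed.

(** * The Lasso *)

(** This replaces a limit at 0: if [u < 0], then [t = 1] forces [v > 0], and [t = - u / (2 * v)]
    gives [u / 2 >= 0]. *)
Lemma ge0_of_linear_bound (R : realFieldType) (u v : R) :
  (forall t, 0 < t <= 1 -> 0 <= u + t * v) -> 0 <= u.
Proof.
move=> H; rewrite leNgt; apply/negP => u0.
have v1 : 0 <= u + v by rewrite -[v]mul1r; apply: H; rewrite ltr01 lexx.
have v0 : 0 < v by lra.
have t01 : 0 < - u / (2 * v) <= 1.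
  rewrite divr_gt0 ?oppr_gt0 ?mulr_gt0//= ler_pdivrMr ?mulr_gt0//; lra.
have := H _ t01.
have -> : u + - u / (2 * v) * v = u / 2 by field; rewrite gt_eqF.
lra.
Qed.

Lemma ler_l1normD (R : realType) p (a b : 'cV[R]_p) :
  l1norm (a + b) <= l1norm a + l1norm b.
Proof.
by rewrite -big_split; apply: ler_sum => i _; rewrite mxE ler_normD.
Qed.

Lemma l1normZ (R : realType) p (t : R) (b : 'cV[R]_p) :
  l1norm (t *: b) = `|t| * l1norm b.
Proof. by rewrite mulr_sumr; apply: eq_bigr => i _; rewrite mxE normrM. Qed.

Section lasso.
Context (R : realType) (n p : nat) (X : 'M[R]_(n, p)) (y : 'cV[R]_n) (l : R)
  (b : 'cV[R]_p).
Hypotheses (n_gt0 : (0 < n)%N) (l_ge0 : 0 <= l) (b_lasso : is_lasso X y l b).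
Let n0 : 0 < n%:R :> R. Proof. by rewrite ltr0n. Qed.

(** First-order optimality, with [D] a bound on the slope of the l1 norm along [h]: compare [b] with
    [b + t *: h], divide by [t] and let [t] tend to 0. *)
Lemma lasso_direction (h : 'cV[R]_p) (D : R) :
  (forall t : R, 0 < t <= 1 -> l1norm (b + t *: h) <= l1norm b + t * D) ->
  dotv (y - X *m b) (X *m h) <= n%:R * l * D.
Proof.
move=> hD; rewrite -subr_ge0.
apply: (@ge0_of_linear_bound _ _ (dotv (X *m h) (X *m h) / 2)) => t t01.
have t0 : 0 < t by case/andP: t01.
have := b_lasso (b + t *: h); rewrite /lasso_objective !l2norm_sqr.
have -> : y - X *m (b + t *: h) = (y - X *m b) - t *: (X *m h).
  by rewrite mulmxDr -scalemxAr opprD addrA.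
move: (y - X *m b) (X *m h) => r g H.
have {}H := le_trans H (lerD (lexx _) (ler_wpM2l l_ge0 (hD _ t01))).
move: H; rewrite !(dotvBl, dotvBr, dotvZl, dotvZr) (dotvC g r) => H.
rewrite -(pmulr_rge0 _ t0).
rewrite [X in 0 <= X](_ : _ = n%:R * ((2 * n%:R)^-1 *
  (dotv r r - t * dotv r g - (t * dotv r g - t * (t * dotv g g))) + l *
  (l1norm b + t * D) - ((2 * n%:R)^-1 * dotv r r + l * l1norm b))).
  by apply: mulr_ge0; [exact: ltW n0|rewrite subr_ge0].
by field; rewrite gt_eqF.
Qed.

Lemma lasso_variational (b' : 'cV[R]_p) :
  dotv (y - X *m b) (X *m (b' - b)) <= n%:R * l * (l1norm b' - l1norm b).
Proof.
apply: lasso_direction => t /andP[t0 t1].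
have -> : b + t *: (b' - b) = (1 - t) *: b + t *: b'.
  by rewrite scalerBr scalerBl scale1r addrCA addrA [RHS]addrC addrA.
rewrite (le_trans (ler_l1normD _ _))// !l1normZ ger0_norm ?subr_ge0//.
by rewrite gtr0_norm//; lra.
Qed.

(** Shrinking a nonzero coordinate lowers the l1 norm at the exact rate [|b k 0|], so the
    correlation of column [k] with the residual must be at least [n%:R * l]. *)
Lemma lasso_kkt (k : 'I_p) : k \in supp b ->
  (n%:R * l) ^+ 2 <= dotv (col k X) (y - X *m b) ^+ 2.
Proof.
rewrite inE => bk0; set r := y - X *m b.
have := @lasso_direction (- (b k 0 *: delta_mx k 0)) (- `|b k 0|).
have -> : X *m (- (b k 0 *: delta_mx k 0)) = - (b k 0 *: col k X).
  by rewrite mulmxN -scalemxAr -colE.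
rewrite dotvNr dotvZr dotvC -/r => /(_ _)/wrap[].
  move=> t /andP[t0 t1]; rewrite mulrN.
  rewrite /l1norm (bigD1 k)//= [X in _ <= X - _](bigD1 k)//=.
  rewrite !mxE !eqxx /= mulr1 mulrN.
  have -> : b k 0 - t * b k 0 = (1 - t) * b k 0 by ring.
  rewrite normrM ger0_norm ?subr_ge0//.
  rewrite (eq_bigr (fun i => `|b i 0|)); last first.
    by move=> i ik; rewrite !mxE (negPf ik) /= mulr0 oppr0 mulr0 addr0.
  lra.
rewrite mulrN lerN2 => h.
have : n%:R * l * `|b k 0| <= `|dotv (col k X) r| * `|b k 0|.
  by rewrite (le_trans h)// (le_trans (ler_norm _))// normrM mulrC.
rewrite ler_pM2r ?normr_gt0// => {}h.
rewrite -[leRHS]real_normK ?num_real// ler_pXn2r// nnegrE.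
by rewrite mulr_ge0// ltW.
Qed.

End lasso.

Lemma proj_supp_perp (R : realType) n p (X : 'M[R]_(n, p)) (T : {set 'I_p})
    (v z : 'cV[R]_n) :
  dotv (z - proj_supp X T *m z) (proj_supp X T *m v) = 0.
Proof.
have [a ->] := proj_supp_sub X T v.
by rewrite dotv_mulmx proj_supp_compl dotvC dotv0.
Qed.

Lemma proj_supp_pythagoras (R : realType) n p (X : 'M[R]_(n, p))
    (T : {set 'I_p}) (v : 'cV[R]_n) :
  dotv v v = dotv (proj_supp X T *m v) (proj_supp X T *m v) +
    dotv (v - proj_supp X T *m v) (v - proj_supp X T *m v).
Proof.
have := proj_supp_perp X T v v; move: (proj_supp X T *m v) => u.
rewrite !(dotvBl, dotvBr) (dotvC v u); lra.
Qed.

Lemma proj_supp_id (R : realType) n p (X : 'M[R]_(n, p)) (b : 'cV[R]_p) :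
  proj_supp X (supp b) *m (X *m b) = X *m b.
Proof.
have E : X *m b = restr_cols X (supp b) *m b.
  apply/matrixP => i j; rewrite ord1 !mxE; apply: eq_bigr => k _.
  by rewrite mxE inE; case: eqP => // ->; rewrite !mulr0.
apply/eqP; rewrite eq_sym -subr_eq0 -dotv_eq0 dotvBr proj_supp_perp subr0.
by rewrite [X in dotv _ X]E dotv_mulmx proj_supp_compl dotvC dotv0.
Qed.

(** * Restricted eigenvalues and the Lasso residual *)

Section restricted_eigenvalue.
Context (R : realType) (n p : nat) (X : 'M[R]_(n, p)) (s : nat).
Hypotheses (n_gt0 : (0 < n)%N) (RE_X : RE X s 3).
Let k := kappa X s 3.
Let k0 : 0 < k. Proof. by case: RE_X. Qed.
Let n0 : 0 < n%:R :> R. Proof. by rewrite ltr0n. Qed.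

(** The product form also covers a zero restriction. The ratios are bounded below by 0, so their
    infimum is at most each of them. *)
Lemma kappa_le (T : {set 'I_p}) (D : 'cV[R]_p) : (#|T| <= s)%N ->
  l1norm (restr (~: T)%SET D) <= 3 * l1norm (restr T D) ->
  k ^+ 2 * n%:R * dotv (restr T D) (restr T D) <= dotv (X *m D) (X *m D).
Proof.
move=> Ts cone; have [->|D0] := eqVneq (restr T D) 0.
  by rewrite dotv0 mulr0 dotv_ge0.
have dD : 0 < l2norm (restr T D).
  rewrite lt_def sqrtr_ge0 andbT -sqrf_eq0 l2norm_sqr.
  by rewrite dotv_eq0.
have : k <= l2norm (X *m D) / (Num.sqrt n%:R * l2norm (restr T D)).
  apply: ge_inf; last by exists T, D.
  exists 0 => _ [T' [D' [_ _ _ ->]]].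
  by rewrite divr_ge0 ?mulr_ge0 ?sqrtr_ge0.
have dn : 0 < Num.sqrt n%:R * l2norm (restr T D) by rewrite mulr_gt0// sqrtr_gt0.
rewrite ler_pdivlMr// => h.
rewrite -!l2norm_sqr -[X in _ * X * _](@sqr_sqrtr _ n%:R) ?ler0n//.
by rewrite -!exprMn -mulrA ler_pXn2r// nnegrE ?mulr_ge0 ?sqrtr_ge0// ltW.
Qed.

(** Testing the restricted eigenvalue on one coordinate vector gives [k ^+ 2 <= phi]. Positivity
    later permits division by [phi]. *)
Lemma kappa_le_phi (phi : R) :
  (forall x : 'cV[R]_p, dotv (X *m x) (X *m x) <= n%:R * phi * dotv x x) ->
  0 < phi.
Proof.
case: (RE_X) => /andP[s0 sp] _ hphi.
have p0 : (0 < p)%N by exact: leq_trans sp.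
pose k1 := Ordinal p0; pose e := delta_mx k1 0 : 'cV[R]_p.
have ee : dotv e e = 1.
  rewrite /dotv (bigD1 k1)//= big1 ?addr0.
    by rewrite !mxE !eqxx mulr1.
  by move=> i /negPf ik; rewrite !mxE ik /= mulr0.
have re : restr [set k1]%SET e = e.
  by apply/matrixP => i j; rewrite (ord1 j) !mxE inE; case: eqP.
have r0 : restr (~: [set k1])%SET e = 0.
  by apply/matrixP => i j; rewrite (ord1 j) !mxE !inE; case: eqP.
have := @kappa_le [set k1]%SET e; rewrite cards1 re r0 ee => /(_ s0).
have -> : l1norm (0 : 'cV[R]_p) = 0.
  by apply: big1 => i _; rewrite mxE normr0.
have l1e : 0 <= 3 * l1norm e by rewrite mulr_ge0 ?sumr_ge0.
move=> /(_ l1e) h; have := le_trans h (hphi e); rewrite ee !mulr1 => {}h.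
have : 0 < n%:R * phi by apply: lt_le_trans h; rewrite mulr_gt0 ?exprn_gt0.
by rewrite pmulr_rgt0.
Qed.

(** Expanding [|y - X betas|^2] around [y - X b] leaves a term [|w|^2], which absorbs the difference
    of the l1 norms. *)
Lemma lasso_prediction (y : 'cV[R]_n) (l : R) (b betas : 'cV[R]_p) :
  s = l0norm betas -> 0 <= l -> is_lasso X y l b ->
  dotv (y - X *m b) (y - X *m b) <=
    n%:R * l ^+ 2 * s%:R / k ^+ 2
    + dotv (y - X *m betas) (y - X *m betas).
Proof.
move=> sE l0 bl; set T := supp betas; pose D := b - betas; pose w := X *m D.
suff main : 2 * (n%:R * l * (l1norm betas - l1norm b)) <=
    n%:R * l ^+ 2 * s%:R / k ^+ 2 + dotv w w.
  have := lasso_variational n_gt0 l0 bl betas.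
  have -> : X *m (betas - b) = - w by rewrite /w /D -mulmxN opprB.
  have -> : y - X *m betas = (y - X *m b) + w.
    by rewrite /w /D mulmxBr; move: (X *m b) (X *m betas) => u v; rewrite addrA subrK.
  move: main; move: (y - X *m b) w => r w main.
  rewrite dotvNr !(dotvDl, dotvDr) (dotvC w r); lra.
(* Off [T] the vector [D] coincides with [b], whence the minus sign; on [T] this is the triangle
   inequality. *)
have l1D : l1norm betas - l1norm b <=
    l1norm (restr T D) - l1norm (restr (~: T)%SET D).
  rewrite /l1norm -!sumrB; apply: ler_sum => i _; rewrite !mxE !inE.
  case: eqP => [->|_] /=; rewrite ?normr0 ?subr0 ?sub0r//.
  by rewrite distrC lerB_dist.
have w0 : 0 <= dotv w w by exact: dotv_ge0.
have A0 : 0 <= n%:R * l ^+ 2 * s%:R / k ^+ 2.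
  by rewrite !mulr_ge0 ?invr_ge0 ?exprn_ge0// ltW.
have T0 : 0 <= l1norm (restr T D) by exact: sumr_ge0.
have Tc0 : 0 <= l1norm (restr (~: T)%SET D) by exact: sumr_ge0.
have nl0 : 0 <= n%:R * l by rewrite mulr_ge0// ltW.
have h : n%:R * l * (l1norm betas - l1norm b) <= n%:R * l *
    (l1norm (restr T D) - l1norm (restr (~: T)%SET D)) by exact: ler_wpM2l.
(* Outside the cone the l1 difference is nonpositive, which settles [main]; inside, [kappa_le]
   applies. *)
have [cone|] := leP (l1norm (restr (~: T)%SET D)) (3 * l1norm (restr T D)); last first.
  move=> ncone; suff : n%:R * l *
    (l1norm (restr T D) - l1norm (restr (~: T)%SET D)) <= 0 by lra.
  by rewrite mulr_ge0_le0// subr_le0; lra.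
have {}h : n%:R * l * (l1norm betas - l1norm b) <=
    n%:R * l * l1norm (restr T D).
  by rewrite (le_trans h)// ler_wpM2l// gerBl.
have Ts : (#|T| <= s)%N by rewrite sE.
have kw := kappa_le Ts cone; rewrite -/w in kw.
have cs : l1norm (restr T D) ^+ 2 <= s%:R * dotv (restr T D) (restr T D).
  (* Cauchy-Schwarz against the signs on [T], a vector of squared norm at most [s]. *)
  pose g : 'cV[R]_p := \col_i (if i \in T then Num.sg (D i 0) else 0).
  have gr : l1norm (restr T D) = dotv g (restr T D).
    apply: eq_bigr => i _; rewrite !mxE; case: ifP => _; last by rewrite normr0 mul0r.
    exact: normrEsg.
  have gs : dotv g g <= s%:R.
    rewrite sE /l0norm -sum1_card natr_sum big_mkcond /=; apply: ler_sum => i _.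
    rewrite !mxE -/T; case: ifP => _; last by rewrite mul0r.
    by case: sgrP => _; rewrite ?mulr1 ?mulrNN ?mulr1 ?mul0r.
  rewrite gr (le_trans (dotv_cauchy_schwarz _ _))//.
  by rewrite ler_wpM2r ?dotv_ge0.
have s0 : 0 < s%:R :> R by case: (RE_X) => /andP[s0 _] _; rewrite ltr0n.
(* AM-GM: [2 l d <= l^2 s / k^2 + k^2 d^2 / s] with [d = |D_T|_1] *)
move: (l1norm (restr T D)) (dotv (restr T D) (restr T D)) h kw cs => d q h kw cs.
have e1 : 2 * (n%:R * l * d) <=
    n%:R * l ^+ 2 * s%:R / k ^+ 2 + k ^+ 2 * n%:R * (d ^+ 2 / s%:R).
  rewrite -subr_ge0 [X in 0 <= X](_ : _ =
    n%:R / (s%:R * k ^+ 2) * (l * s%:R - k ^+ 2 * d) ^+ 2).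
    by rewrite mulr_ge0 ?sqr_ge0// divr_ge0 ?mulr_ge0 ?exprn_ge0// ltW.
  by field; rewrite !gt_eqF.
have e2 : k ^+ 2 * n%:R * (d ^+ 2 / s%:R) <= k ^+ 2 * n%:R * q.
  by rewrite ler_pM2l ?mulr_gt0 ?exprn_gt0// ler_pdivrMr// mulrC.
lra.
Qed.

End restricted_eigenvalue.

(** * The largest eigenvalue and the size of the Lasso support *)

Section spectral_bound.
Context (R : realType) (n p : nat) (X : 'M[R]_(n, p)) (phi : R).
Hypothesis n_gt0 : (0 < n)%N.
Let n0 : 0 < n%:R :> R. Proof. by rewrite ltr0n. Qed.

Lemma gram_eigenvalue_bound :
  is_largest_eigenvalue (n%:R^-1 *: (X^T *m X)) phi ->
  forall x : 'cV[R]_p, dotv (X *m x) (X *m x) <= n%:R * phi * dotv x x.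
Proof.
move=> [_ phi_ge] x; rewrite dotv_mulmx dotvC mulmxA.
have : dotv x (n%:R^-1 *: (X^T *m X) *m x) <= phi * dotv x x.
  by apply: rayleigh_le => //; rewrite linearZ /= trmx_mul trmxK.
by rewrite -scalemxAl dotvZr ler_pdivrMl// mulrA.
Qed.

Hypothesis phi_ge0 : 0 <= phi.
Hypothesis hphi : forall x : 'cV[R]_p,
  dotv (X *m x) (X *m x) <= n%:R * phi * dotv x x.

(** [X^T] inherits the bound of [X]: for [a = X^T v], Cauchy-Schwarz gives [|a|^4 = (dotv v (X a))^2
    <= |v|^2 |X a|^2]. *)
Lemma trmx_bound (v : 'cV[R]_n) :
  dotv (X^T *m v) (X^T *m v) <= n%:R * phi * dotv v v.
Proof.
set a := X^T *m v; have [->|aN0] := eqVneq a 0.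
  by rewrite dotv0 !mulr_ge0 ?dotv_ge0// ltW.
have aa : 0 < dotv a a by rewrite lt_def dotv_eq0 aN0 dotv_ge0.
have := dotv_cauchy_schwarz v (X *m a); rewrite dotv_mulmx -/a => h.
rewrite -(ler_pM2r aa) -expr2 (le_trans h)//.
by rewrite [leRHS]mulrAC [leRHS]mulrC ler_wpM2l ?dotv_ge0.
Qed.

(** Sum the squared KKT inequalities over the support. Columns there see only the projected
    residual, and the sum is at most [|X^T Pr|^2]. *)
Lemma lasso_support_size (y : 'cV[R]_n) (l : R) (b : 'cV[R]_p)
    (r := y - X *m b) (Pr := proj_supp X (supp b) *m r) :
  0 <= l -> is_lasso X y l b ->
  #|supp b|%:R * (n%:R * l ^+ 2) <= phi * dotv Pr Pr.
Proof.
move=> l0 bl; rewrite -(ler_pM2l n0).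
apply: (@le_trans _ _ (dotv (X^T *m Pr) (X^T *m Pr))); last first.
  by rewrite mulrA; exact: trmx_bound.
apply: (@le_trans _ _ (\sum_(k in supp b) dotv (col k X) Pr ^+ 2)).
  have -> : n%:R * (#|supp b|%:R * (n%:R * l ^+ 2)) =
      \sum_(k in supp b) (n%:R * l) ^+ 2.
    by rewrite sumr_const -[RHS]mulr_natr exprMn; ring.
  apply: ler_sum => k kS; rewrite (le_trans (lasso_kkt n_gt0 l0 bl kS))//.
  have := @proj_supp_orth _ _ _ X _ r k kS; rewrite dotvBr => /eqP; rewrite subr_eq0.
  by move=> /eqP ->.
rewrite big_mkcond; apply: ler_sum => k _.
have -> : (X^T *m Pr) k 0 = dotv (col k X) Pr.
  by rewrite mxE; apply: eq_bigr => i _; rewrite !mxE.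
by rewrite -expr2; case: ifP => // _; exact: sqr_ge0.
Qed.

End spectral_bound.

(** Pythagoras splits the Lasso residual: the projected part pays for the size of the support, and
    the orthogonal part is that of [y] because the projection fixes [X b]. *)
Lemma lasso_support_residual (R : realType) (n p s : nat) (X : 'M[R]_(n, p))
    (phi l : R) (y : 'cV[R]_n) (b betas : 'cV[R]_p) :
  (0 < n)%N -> RE X s 3 -> 0 < phi ->
  (forall x : 'cV[R]_p, dotv (X *m x) (X *m x) <= n%:R * phi * dotv x x) ->
  s = l0norm betas -> 0 <= l -> is_lasso X y l b ->
  #|supp b|%:R * (n%:R * l ^+ 2) / phi
    + dotv (y - proj_supp X (supp b) *m y) (y - proj_supp X (supp b) *m y) <=
  n%:R * l ^+ 2 * s%:R / kappa X s 3 ^+ 2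
    + dotv (y - X *m betas) (y - X *m betas).
Proof.
move=> n0 REX phi0 hphi sE l0 bl.
rewrite (le_trans _ (lasso_prediction n0 REX sE l0 bl))//.
rewrite (proj_supp_pythagoras X (supp b) (y - X *m b)).
apply: lerD.
  rewrite ler_pdivrMr// mulrC; rewrite [leRHS]mulrC.
  by have := lasso_support_size n0 (ltW phi0) hphi l0 bl; rewrite mulrC.
rewrite mulmxBr proj_supp_id opprB addrA subrK.
by [].
Qed.

(** The level need not be a knot. Between knots the support is that of some knot; above the first
    knot the solution is 0, and [bhat (lam 0)] is shown to be 0 too. *)
Lemma lasso_path_support (R : realType) n p (X : 'M[R]_(n, p)) (y : 'cV[R]_n)
    (bhat : R -> 'cV[R]_p) (K : nat) (lam : nat -> R) (l : R) :
  (0 < n)%N -> (forall l, 0 <= l -> is_lasso X y l (bhat l)) ->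
  is_lasso_knots bhat K lam -> 0 <= l ->
  supp (bhat l) \in path_supports bhat K lam.
Proof.
move=> n_gt0 bl [K0 lamS lamK lam0 lamI] l0.
have knot j : (j <= K)%N -> supp (bhat (lam j)) \in path_supports bhat K lam.
  by move=> jK; apply/imsetP; exists (Ordinal (jK : (j < K.+1)%N)).
have n0 : 0 < n%:R :> R by rewrite ltr0n.
have lamle i : (i <= K)%N -> 0 <= lam (K - i)%N.
  elim: i => [_|i IH iK]; first by rewrite subn0 lamK.
  rewrite (le_trans (IH (ltnW iK)))// ltW//.
  have -> : (K - i)%N = (K - i.+1).+1 by rewrite subnSK.
  by apply: lamS; rewrite ltn_subrL K0.
have lam00 : 0 < lam 0%N.
  have := lamle K.-1 (leq_pred K); rewrite -subn1 subKn//.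
  by move=> /le_lt_trans; apply; exact: lamS.
have [l_gt|l_le] := ltP (lam 0%N) l.
  rewrite lam0//; suff <- : bhat (lam 0%N) = 0 by exact: knot.
  set b := bhat _.
  have b_min : is_lasso X y (lam 0%N) b by apply: bl; exact: ltW.
  have l1_0 : l1norm (0 : 'cV[R]_p) = 0.
    by apply: big1 => i _; rewrite mxE normr0.
  (* 0 is a minimizer at every level above [lam 0], hence at [lam 0] by letting the level decrease
     to it. *)
  have zero_min : is_lasso X y (lam 0%N) 0.
    move=> b'; rewrite -subr_ge0.
    apply: (@ge0_of_linear_bound _ _ (l1norm b')) => t /andP[t0 _].
    have lt : lam 0%N < lam 0%N + t by rewrite ltrDl.
    have := bl (lam 0%N + t) (ltW (lt_trans lam00 lt)) b'.
    rewrite (lam0 _ lt) /lasso_objective l1_0 !mulr0; lra.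
  have := lasso_variational n_gt0 (ltW lam00) b_min 0.
  have := lasso_variational n_gt0 (ltW lam00) zero_min b.
  rewrite !subr0 mulmx0 subr0 sub0r mulmxN l1_0 sub0r subr0 dotvNr dotvBl.
  (* The variational inequalities of the two minimizers add up to [|X b|^2 <= 0]; then [h2] forces
     the l1 norm of [b] to vanish. *)
  move=> h1 h2; have Xb0 : X *m b = 0.
    by apply/eqP; rewrite -dotv_eq0 eq_le dotv_ge0 andbT; lra.
  move: h2; rewrite Xb0 !dotv0 => h2.
  have nl : 0 < n%:R * lam 0%N by rewrite mulr_gt0.
  have b0 : l1norm b <= 0 by rewrite -(pmulr_rle0 _ nl); lra.
  apply/matrixP => i j; rewrite (ord1 j) mxE; apply/eqP; rewrite -normr_le0.
  rewrite (le_trans _ b0)// /l1norm (bigD1 i)//= lerDl.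
  by apply: sumr_ge0.
have locate m : (m <= K)%N -> lam m <= l -> l = lam 0%N \/
    exists2 k, (k < K)%N & lam k.+1 <= l <= lam k.
  elim: m => [_ l_ge|m IH mK lm]; first by left; apply/eqP; rewrite eq_le l_le.
  have [l_lt|/IH] := ltP l (lam m); last by apply; exact: ltnW.
  by right; exists m; rewrite ?lm ?ltW.
have [|->|[k kK /andP[kl lk]]] := locate K (leqnn K); first by rewrite lamK.
  exact: knot.
have [<-|Nkl] := eqVneq (lam k.+1) l; first exact: knot.
have [->|Nlk] := eqVneq l (lam k); first by apply: knot; exact: ltnW.
have [j jK ->] := lamI k kK; first exact: knot.
by rewrite !lt_neqAle Nkl kl Nlk lk.
Qed.

(** * Penalties and Q-aggregation *)

(** From [exp(-1/6) >= 5/6] and [(5/6)^6 > 1/3]. *)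
Lemma expRN1_gt (R : realType) : 3^-1 < expR (-1 : R).
Proof.
have -> : (-1 : R) = 6%:R * (- 6^-1) by field.
rewrite expRM_natl; apply: (@lt_le_trans _ _ ((1 - 6^-1) ^+ 6)); first by lra.
rewrite ler_pXn2r ?nnegrE ?expR_ge0 ?expR_ge1Dx//; lra.
Qed.

Lemma ln3_ge1 (R : realType) : 1 <= ln (3 : R).
Proof.
rewrite -ler_expR lnK ?posrE//.
have -> : expR 1 = (expR (-1 : R))^-1 by rewrite expRN invrK.
by rewrite invf_ple ?posrE ?expR_gt0//; exact/ltW/expRN1_gt.
Qed.

(** Since [3^3 < 2^5], [5 ln 2 >= 3 ln 3 >= 3]. *)
Lemma ln2_ge (R : realType) : 3 / 5 <= ln (2 : R).
Proof.
have : ln (27 : R) <= ln (32 : R) by rewrite ler_ln ?posrE//; lra.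
have -> : (27 : R) = 3 ^+ 3 by ring.
have -> : (32 : R) = 2 ^+ 5 by ring.
rewrite !lnXn//; have := ln3_ge1 R; lra.
Qed.

Lemma ffact_leX (p N : nat) : (p ^_ N <= p ^ N)%N.
Proof.
elim: N => [//|N IH]; rewrite ffactnSr expnSr leq_mul// leq_subr//.
Qed.

(** Every factor of the factorial from 3 on is at least 3. *)
Lemma ln_fact_ge (R : realType) (N : nat) :
  ln 2 + N%:R * ln 3 <= ln (N.+2)`!%:R :> R.
Proof.
elim: N => [|N IH]; first by rewrite mul0r addr0.
rewrite factS natrM lnM ?posrE ?ltr0n ?fact_gt0//.
have : ln 3 <= ln (N.+3%:R : R) by rewrite ler_ln ?posrE ?ltr0n// ler_nat.
rewrite -[N.+1%:R]natr1 mulrDl mul1r; lra.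
Qed.

(* [N!] in the denominator of the binomial coefficient absorbs [e^N]. *)
Lemma ln_bin_bound (R : realType) (p N : nat) : (0 < p)%N -> (N <= p)%N ->
  26 * (ln ('C(p, N)%:R : R) + N%:R) <= 26 + 36 * (N%:R * ln p%:R).
Proof.
move=> p0 Np; have L0 : 0 <= ln (p%:R : R) by rewrite ln_ge0// ler1n.
have : ln ('C(p, N)%:R : R) + ln (N`!%:R) <= N%:R * ln p%:R.
  rewrite -lnM ?posrE ?ltr0n ?bin_gt0 ?fact_gt0// -natrM bin_ffact.
  rewrite mulr_natl -lnXn ?ltr0n// -natrX ler_ln ?posrE ?ltr0n ?ffact_gt0//.
    by rewrite ler_nat ffact_leX.
  by rewrite expn_gt0 p0.
have ln2 := ln2_ge R; have ln3 := ln3_ge1 R.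
(* Sizes 0 and 1 fit directly. Size 2 reduces to [26 <= 46 ln 2], by [p >= 2]. From size 3 on,
   [p >= 3] gives [ln p >= 1]. *)
case: N Np => [|[|N]] Np.
- rewrite fact0 ln1; lra.
- rewrite (_ : 1`! = 1%N)// ln1; lra.
move=> h; have hf := ln_fact_ge R N.
case: N Np h hf => [|N] Np h hf.
  have : ln 2 <= ln (p%:R : R) by rewrite ler_ln ?posrE ?ltr0n// ler_nat.
  lra.
have : 1 <= ln (p%:R : R).
  rewrite (le_trans ln3)// ler_ln ?posrE ?ltr0n// ler_nat.
  exact: leq_trans Np.
move: hf h; rewrite -[N.+3%:R]natr1 -[N.+2%:R]natr1 -[N.+1%:R]natr1 => hf h L1.
have N0 : 0 <= N%:R :> R by [].
have := ler_wpM2l N0 L1; have := ler_wpM2l N0 ln3; lra.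
Qed.

(* [26 sigma^2 log (1 / pi_T)] without the contribution of [log H_p], which is
   the same for all supports and cancels. *)
Definition pen (R : realType) (sigma : R) (p : nat) (T : {set 'I_p}) : R :=
  26 * sigma ^+ 2 * (ln ('C(p, #|T|)%:R) + #|T|%:R).

Lemma card_set_le p (T : {set 'I_p}) : (#|T| <= p)%N.
Proof. by rewrite -[leqRHS]card_ord max_card. Qed.

Lemma Hconst_gt0 (R : realType) p : 0 < Hconst R p.
Proof.
have e1 : 1 < expR (1 : R) by rewrite expR_gt1.
have ep : expR (- p%:R : R) <= 1 by rewrite expR_le1 oppr_le0.
by rewrite /Hconst divr_gt0// subr_gt0 ?(le_lt_trans ep).
Qed.

Lemma ln_supp_weight (R : realType) p (T : {set 'I_p}) :
  ln (supp_weight R T)^-1 =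
  ln (Hconst R p) + (ln ('C(p, #|T|)%:R) + #|T|%:R).
Proof.
have H0 := Hconst_gt0 R p.
rewrite invrK !lnM ?posrE ?mulr_gt0 ?expR_gt0 ?ltr0n ?bin_gt0 ?card_set_le//.
by rewrite expRK addrA.
Qed.

Section Q_aggregation.
Context (R : realType) (n p : nat) (X : 'M[R]_(n, p)) (sigma : R)
  (y : 'cV[R]_n) (F : {set {set 'I_p}}) (theta : {set 'I_p} -> R).
Hypotheses (simF : simplex F theta)
  (minF : forall theta', simplex F theta' ->
     Q_objective X sigma y F theta <= Q_objective X sigma y F theta').
Let m := mu_mix X y F theta.
Let muh T := proj_supp X T *m y.

Lemma dotv_mu_mix (mu v : 'cV[R]_n) :
  dotv v (m - mu) = \sum_(T in F) theta T * dotv v (muh T - mu).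
Proof.
have -> : m - mu = \sum_(T in F) theta T *: (muh T - mu).
  under eq_bigr do rewrite scalerBr.
  by rewrite sumrB -scaler_suml (proj1 simF) scale1r.
by rewrite dotv_sumr; apply: eq_bigr => T _; rewrite dotvZr.
Qed.

(** At the vertex [S] the dispersion vanishes. The weights sum to one, so the [ln (Hconst R p)]
    contributions of the two sides cancel. *)
Lemma Q_le_vertex (S : {set 'I_p}) : S \in F ->
  dotv (m - y) (m - y)
  + 2^-1 * (\sum_(T in F) theta T * dotv (muh T - m) (muh T - m))
  + \sum_(T in F) theta T * pen sigma T
  <= dotv (muh S - y) (muh S - y) + pen sigma S.
Proof.
move=> SF; pose e T : R := (T == S)%:R.
have sume (f : {set 'I_p} -> R) : \sum_(T in F) e T * f T = f S.
  rewrite (bigD1 S)//= /e eqxx mul1r big1 ?addr0// => T /andP[_ /negPf ->].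
  by rewrite mul0r.
have mix_e : mu_mix X y F e = muh S.
  rewrite /mu_mix (bigD1 S)//= /e eqxx scale1r big1 ?addr0//.
  by move=> T /andP[_ /negPf ->]; rewrite scale0r.
have penE (f : {set 'I_p} -> R) : \sum_(T in F) f T = 1 ->
    26 * sigma ^+ 2 * (\sum_(T in F) f T * ln (supp_weight R T)^-1) =
    26 * sigma ^+ 2 * ln (Hconst R p) + \sum_(T in F) f T * pen sigma T.
  move=> f1; under eq_bigr do rewrite ln_supp_weight mulrDr.
  rewrite big_split /= -mulr_suml f1 mul1r mulrDr; congr (_ + _).
  by rewrite mulr_sumr; apply: eq_bigr => T _; rewrite /pen mulrCA.
have se : simplex F e.
  split; first by under eq_bigr do rewrite -[e _]mulr1; exact: sume.
  by move=> T _; rewrite /e ler0n.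
have := minF se; rewrite /Q_objective !penE ?(proj1 se) ?(proj1 simF)//.
rewrite mix_e !sume; under eq_bigr do rewrite l2norm_sqr.
rewrite !l2norm_sqr -/(muh S) subrr dotv0 -/m; lra.
Qed.

(** The dispersion is [V = sd - |m - mu|^2]. The bound [B] costs [sd / 4]: the share [V / 4] is
    covered by the [V / 2] of the criterion, and the share [|m - mu|^2 / 4] leaves the factor
    3/4. *)
Lemma Q_oracle (mu : 'cV[R]_n) (S : {set 'I_p}) (B : R) : S \in F ->
  (forall T, 2 * dotv (y - mu) (muh T - mu)
     - 4^-1 * dotv (muh T - mu) (muh T - mu) - pen sigma T <= B) ->
  3 / 4 * dotv (m - mu) (m - mu) <=
  dotv (y - muh S) (y - muh S) + pen sigma S - dotv (y - mu) (y - mu) + B.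
Proof.
move=> SF hB; have := Q_le_vertex SF.
have -> : dotv (muh S - y) (muh S - y) = dotv (y - muh S) (y - muh S).
  by rewrite -[muh S - y]opprB dotvNl dotvNr opprK.
pose sd := \sum_(T in F) theta T * dotv (muh T - mu) (muh T - mu).
pose sx := \sum_(T in F) theta T * dotv (y - mu) (muh T - mu).
have t0 T : T \in F -> 0 <= theta T by move=> TF; exact: (proj2 simF).
set V := \sum_(T in F) _ * dotv (_ - m) _.
have V0 : 0 <= V by apply: sumr_ge0 => T TF; rewrite mulr_ge0 ?t0 ?dotv_ge0.
have VE : V = sd - dotv (m - mu) (m - mu).
  rewrite /V /sd.
  transitivity (\sum_(T in F) (theta T * dotv (muh T - mu) (muh T - mu)
    - 2 * (theta T * dotv (m - mu) (muh T - mu))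
    + theta T * dotv (m - mu) (m - mu))).
    apply: eq_bigr => T _.
    have -> : muh T - m = (muh T - mu) - (m - mu).
      by rewrite opprB addrA subrK.
    move: (muh T - mu) (m - mu) => u v.
    by rewrite !(dotvBl, dotvBr) (dotvC u v); ring.
  rewrite big_split sumrB /= -mulr_suml (proj1 simF) mul1r -mulr_sumr.
  rewrite -dotv_mu_mix; ring.
have xE : dotv (y - mu) (m - mu) = sx by exact: dotv_mu_mix.
have myE : dotv (m - y) (m - y) = dotv (m - mu) (m - mu) - 2 * sx
    + dotv (y - mu) (y - mu).
  rewrite -xE; have -> : m - y = (m - mu) - (y - mu).
    by rewrite opprB addrA subrK.
  move: (m - mu) (y - mu) => u v.
  by rewrite !(dotvBl, dotvBr) (dotvC v u); ring.
have : 2 * sx - 4^-1 * sd - \sum_(T in F) theta T * pen sigma T <= B.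
  apply: (@le_trans _ _ (\sum_(T in F) theta T * B)); last first.
    by rewrite -mulr_suml (proj1 simF) mul1r.
  rewrite !mulr_sumr -!sumrB; apply: ler_sum => T TF.
  have := ler_wpM2l (t0 _ TF) (hB T); lra.
rewrite myE; lra.
Qed.

End Q_aggregation.

(** * The stochastic term *)

(** For the observation [mu + x], the quantity bounded in [Q_oracle] before the penalty is
    subtracted. *)
Definition dev (R : realType) n p (X : 'M[R]_(n, p)) (mu : 'cV[R]_n)
    (T : {set 'I_p}) (x : 'cV[R]_n) : R :=
  let d := proj_supp X T *m (mu + x) - mu in
  2 * dotv x d - 4^-1 * dotv d d.

(** With [q = Pi_T x] orthogonal to [m = mu - Pi_T mu], the deviation is
    [7/4 |q|^2 - 2 dotv x m - |m|^2 / 4]. At the scale [8 sigma^2] the last term is exactly minus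
    the Gaussian log-moment of the linear part. *)
Lemma dev_quadratic (R : realType) n p (X : 'M[R]_(n, p)) (mu : 'cV[R]_n)
    (T : {set 'I_p}) (sigma : R) : 0 < sigma ->
  exists (us : seq 'cV[R]_n) (c : 'cV[R]_n),
    [/\ orthonormal us, (size us <= #|T|)%N,
        forall u, u \in us -> dotv u c = 0
      & forall x, dev X mu T x / (8 * sigma ^+ 2) =
          7 / (32 * sigma ^+ 2) * (\sum_(u <- us) dotv u x ^+ 2) + dotv c x
          - sigma ^+ 2 * dotv c c / 2].
Proof.
move=> s0; have [us [ous sus PE]] := proj_supp_orthonormal X T.
pose m := mu - proj_supp X T *m mu.
exists us, (- (4 * sigma ^+ 2)^-1 *: m); split => // [u uus|x].
  rewrite dotvZr /m dotvBr PE (dotv_orthonormal_sum (fun x => dotv x mu))//.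
  by rewrite subrr mulr0.
have xP : \sum_(u <- us) dotv u x ^+ 2 = dotv x (proj_supp X T *m x).
  rewrite PE dotv_sumr; apply: eq_bigr => u _.
  by rewrite dotvZr (dotvC x) expr2.
have PP : dotv (proj_supp X T *m x) (proj_supp X T *m x) =
    dotv x (proj_supp X T *m x).
  have := proj_supp_perp X T x x; rewrite dotvBl => /eqP.
  by rewrite subr_eq0 => /eqP.
have mP : dotv m (proj_supp X T *m x) = 0 by exact: proj_supp_perp.
rewrite /dev xP.
have -> : proj_supp X T *m (mu + x) - mu = proj_supp X T *m x - m.
  by rewrite mulmxDr /m opprB addrA [_ *m x + _]addrC.
move: (proj_supp X T *m x) m mP PP => q m mP PP.
rewrite !(dotvBl, dotvBr, dotvZl, dotvZr) PP (dotvC q m) mP (dotvC x m).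
by field; rewrite gt_eqF.
Qed.

Section noise.
Context d (Omega : measurableType d) (R : realType) (P : probability Omega R)
  (n p : nat) (X : 'M[R]_(n, p)) (mu : 'cV[R]_n) (sigma : R)
  (xi : 'I_n -> {RV P >-> R}).
Hypotheses (sigma_gt0 : 0 < sigma) (xi_gauss : is_gaussian_noise sigma xi).

(** The sum runs over all supports because those on the path depend on the noise. *)
Definition noise (w : Omega) : R := \sum_(T : {set 'I_p})
  expR ((dev X mu T (rvec xi w) - pen sigma T) / (8 * sigma ^+ 2)).

Lemma noise_gt0 (w : Omega) : 0 < noise w.
Proof.
by rewrite /noise (bigD1 [set: 'I_p]%SET)//= ltr_pwDl ?expR_gt0// sumr_ge0.
Qed.

Lemma noise_ge (w : Omega) (T : {set 'I_p}) :
  dev X mu T (rvec xi w) - pen sigma T <= 8 * sigma ^+ 2 * ln (noise w).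
Proof.
have s0 : 0 < 8 * sigma ^+ 2 by rewrite mulr_gt0 ?exprn_gt0.
rewrite mulrC -ler_pdivrMr// -[leLHS]expRK ler_ln ?posrE ?expR_gt0 ?noise_gt0//.
by rewrite /noise (bigD1 T)//= lerDl sumr_ge0.
Qed.

Let term (T : {set 'I_p}) (w : Omega) :=
  expR ((dev X mu T (rvec xi w) - pen sigma T) / (8 * sigma ^+ 2)).

(** For [a = 7 / (32 sigma^2)], [1 - 2 a sigma^2 = (3/4)^2], so each basis vector costs a factor
    4/3. With [C] the binomial coefficient, the penalty gives
    [exp(-13/4 (ln C + |T|)) <= C^-1 4^-|T|], as [e^3 >= 4]; finally [(4/3) / 4 <= 1/2]. *)
Lemma term_mgf (T : {set 'I_p}) : measurable_fun setT (term T) /\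
  (\int[P]_w (term T w)%:E <= ((2 ^+ #|T| * 'C(p, #|T|)%:R)^-1)%:E)%E.
Proof.
have [us [c [ous sus uc devE]]] := dev_quadratic X mu T sigma_gt0.
pose k := expR (- pen sigma T / (8 * sigma ^+ 2) - sigma ^+ 2 * dotv c c / 2).
have tE w : term T w = k *
    expR (7 / (32 * sigma ^+ 2) * (\sum_(u <- us) dotv u (rvec xi w) ^+ 2)
          + dotv c (rvec xi w)).
  rewrite /term /k -expRD mulrBl devE; congr expR; ring.
have mQ := measurable_quadratic xi (7 / (32 * sigma ^+ 2)) us c.
split; first by rewrite (funext tE); exact: measurable_funM.
under eq_integral do rewrite tE EFinM.
rewrite ge0_integralZl//; last 2 first.
- exact/measurable_EFinP.
- by rewrite lee_fin expR_ge0.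
rewrite (@gaussian_quadratic_mgf _ _ _ _ _ _ _ sigma_gt0 xi_gauss _
  (3 / 4))//; last 2 first.
- by rewrite divr_ge0// mulr_ge0 ?exprn_ge0// ltW.
- by field; rewrite gt_eqF.
have s2 : sigma != 0 by rewrite gt_eqF.
have C0 : 0 < 'C(p, #|T|)%:R :> R by rewrite ltr0n bin_gt0 card_set_le.
have C1 : 0 <= ln ('C(p, #|T|)%:R : R).
  by rewrite ln_ge0// ler1n bin_gt0 card_set_le.
rewrite -EFinM lee_fin [leLHS]mulrC -[leLHS]mulrA /k -expRD.
have -> : sigma ^+ 2 * dotv c c / 2 + (- pen sigma T / (8 * sigma ^+ 2) -
    sigma ^+ 2 * dotv c c / 2) = - (13 / 4 * (ln 'C(p, #|T|)%:R + #|T|%:R)).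
  by rewrite /pen; field.
rewrite invf_div; apply: (@le_trans _ _ ((4 / 3) ^+ #|T| *
  ('C(p, #|T|)%:R^-1 * 4^-1 ^+ #|T|))).
  have t43 : 1 <= 4 / 3 :> R by lra.
  apply: ler_pM; [|exact: expR_ge0| |].
  - by rewrite exprn_ge0// (le_trans ler01).
  - by rewrite ler_weXn2l.
  - apply: (@le_trans _ _ (expR (- ln 'C(p, #|T|)%:R - #|T|%:R * 3))).
    by rewrite ler_expR; have : 0 <= #|T|%:R :> R by []; lra.
  rewrite expRD expRN lnK ?posrE// ler_pM2l ?invr_gt0//.
  rewrite expRN expRM_natl -exprVn.
  apply: lerXn2r; rewrite ?nnegrE ?invr_ge0 ?expR_ge0//.
  rewrite lef_pV2 ?posrE ?expR_gt0//; apply: le_trans (expR_ge1Dx _); lra.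
rewrite invfM mulrCA [leRHS]mulrC ler_pM2l ?invr_gt0//.
by rewrite -exprMn -exprVn; apply: lerXn2r; rewrite ?nnegrE; lra.
Qed.

Lemma measurable_noise : measurable_fun setT noise.
Proof. by apply: measurable_sum => T; case: (term_mgf T). Qed.

(** The binomial coefficient cancels the number of supports of each size, leaving a geometric series
    of ratio 1/2. *)
Lemma sum_inv_bin : \sum_(T : {set 'I_p}) (2 ^+ #|T| * 'C(p, #|T|)%:R)^-1 <= 2 :> R.
Proof.
rewrite (partition_big (fun T : {set 'I_p} => inord #|T| : 'I_p.+1) predT)//=.
apply: (@le_trans _ _ (\sum_(i < p.+1) 2^-1 ^+ i)).
  apply: ler_sum => i _.
  have cE (T : {set 'I_p}) : (inord #|T| == i) = (#|T| == i).
    by rewrite -val_eqE /= inordK// ltnS card_set_le.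
  rewrite (eq_big (fun T => T \in [set T : {set 'I_p} | #|T| == i]%SET)
      (fun _ => (2 ^+ i * 'C(p, i)%:R)^-1)); first last.
  - by move=> T; rewrite cE => /eqP ->.
  - by move=> T; rewrite inE cE.
  rewrite sumr_const.
  rewrite card_draws card_ord -[leLHS]mulr_natr invfM -mulrA mulVf ?mulr1 ?exprVn//.
  by rewrite pnatr_eq0 -lt0n bin_gt0 -ltnS.
have -> : \sum_(i < p.+1) 2^-1 ^+ i = 2 - 2 * 2^-1 ^+ p.+1 :> R.
  elim: p.+1 => [|q IH]; first by rewrite big_ord0 expr0; ring.
  by rewrite big_ord_recr /= IH exprS; field.
by rewrite gerBl mulr_ge0// exprn_ge0.
Qed.

Lemma expectation_noise : (\int[P]_w (noise w)%:E <= 2%:E)%E.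
Proof.
under eq_integral do rewrite /noise -sumEFin.
rewrite ge0_integral_sum//; last first.
  by move=> T; apply/measurable_EFinP; case: (term_mgf T).
apply: (@le_trans _ _ (\sum_(T : {set 'I_p})
   ((2 ^+ #|T| * 'C(p, #|T|)%:R)^-1)%:E)%E).
  by apply: lee_sum => T _; case: (term_mgf T).
by rewrite sumEFin lee_fin sum_inv_bin.
Qed.

End noise.

(** * Risk bounds for Q-aggregation over the Lasso path *)

Theorem theorem4 (R : realType) (d : measure_display)
  (Omega : measurableType d) (P : probability Omega R)
  (n p : nat) (n_gt0 : (0 < n)%N) (p_gt0 : (0 < p)%N)
  (sigma : R) (sigma_gt0 : 0 < sigma)
  (mu : 'cV[R]_n) (X : 'M[R]_(n, p)) (betas : 'cV[R]_p)
  (mu_def : mu = X *m betas)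
  (s : nat) (s_def : s = l0norm betas)
  (xi : 'I_n -> {RV P >-> R}) (xi_gauss : is_gaussian_noise sigma xi)
  (y : Omega -> 'cV[R]_n) (y_def : forall w, y w = mu + rvec xi w)
  (RE_s3 : RE X s 3)
  (phimax : R)
  (phimax_def : is_largest_eigenvalue (n%:R^-1 *: (X^T *m X)) phimax)
  (bhat : Omega -> R -> 'cV[R]_p)
  (bhat_lasso : forall w (l : R), 0 <= l -> is_lasso X (y w) l (bhat w l))
  (K : Omega -> nat) (lam : Omega -> nat -> R)
  (lam_knots : forall w, is_lasso_knots (bhat w) (K w) (lam w))
  (muQ : 'I_n -> {RV P >-> R})
  (muQ_def : forall w,
     is_Q_estimator X sigma (y w) (path_supports (bhat w) (K w) (lam w))
       (rvec muQ w)) :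
  (forall x : R, 0 < x ->
     ((1 - 3 * expR (- x))%:E <
      P [set w | (emp_sqnorm (rvec muQ w - X *m betas) <=
           ((128 + 48 * phimax) * sigma ^+ 2 * s%:R * ln p%:R)
             / (kappa X s 3 ^+ 2 * n%:R)
           + 24 * sigma ^+ 2 / n%:R
           + 128 * sigma ^+ 2 * s%:R * x / (kappa X s 3 ^+ 2 * n%:R)
           + 22 * sigma ^+ 2 * x / n%:R)%R])%E) /\
  ('E_P[fun w => emp_sqnorm (rvec muQ w - X *m betas)%R] <=
     (((128 + 48 * phimax) * sigma ^+ 2 * s%:R * ln p%:R)
        / (kappa X s 3 ^+ 2 * n%:R)
      + 384 * sigma ^+ 2 * s%:R / (kappa X s 3 ^+ 2 * n%:R)
      + 90 * sigma ^+ 2 / n%:R)%:E)%E.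
Proof.
subst mu.
have n0 : 0 < n%:R :> R by rewrite ltr0n.
have hphi := gram_eigenvalue_bound n_gt0 phimax_def.
have phi0 : 0 < phimax by exact: (kappa_le_phi n_gt0 RE_s3 hphi).
have k0 : 0 < kappa X s 3 by case: RE_s3.
set k := kappa X s 3 in k0 *; pose L := ln (p%:R : R).
have L0 : 0 <= L by rewrite /L ln_ge0// ler1n.
pose err w := emp_sqnorm (rvec muQ w - X *m betas).
pose Y w := noise X (X *m betas) sigma xi w.
pose A := 48 * phimax * sigma ^+ 2 * s%:R * L / (k ^+ 2 * n%:R).
pose v := sigma ^+ 2 / n%:R.
have v0 : 0 < v by rewrite divr_gt0 ?exprn_gt0.
have A0 : 0 <= A.
  by rewrite /A divr_ge0 ?mulr_ge0 ?exprn_ge0// ltW.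
have errE w : err w =
    n%:R^-1 * dotv (rvec muQ w - X *m betas) (rvec muQ w - X *m betas).
  by rewrite /err /emp_sqnorm l2norm_sqr.
(* The constants 48 (in [A]), 104/3 and 32/3 are 36, 26 and 8 times the 4/3 that undoes the factor
   3/4 of [Q_oracle]. *)
have err_le w : err w <= A + 104 / 3 * v + 32 / 3 * v * ln (Y w).
  rewrite errE; have [theta [sim opt ->]] := muQ_def w.
  (* 36 = 48 * 3/4 exceeds 26, as [ln_bin_bound] requires *)
  pose l := Num.sqrt (36 * L * phimax * sigma ^+ 2 / n%:R).
  have l0 : 0 <= l by exact: sqrtr_ge0.
  have nl : n%:R * l ^+ 2 = 36 * L * phimax * sigma ^+ 2.
    rewrite sqr_sqrtr; first by field; rewrite gt_eqF.
    by rewrite divr_ge0 ?mulr_ge0 ?exprn_ge0// ltW.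
  pose S := supp (bhat w l).
  have SF := lasso_path_support n_gt0 (bhat_lasso w) (lam_knots w) l0.
  have yx : y w - X *m betas = rvec xi w.
    by rewrite y_def addrC addKr.
  have := lasso_support_residual n_gt0 RE_s3 phi0 hphi s_def l0 (bhat_lasso w _ l0).
  rewrite -/k -/S yx nl.
  have -> : #|S|%:R * (36 * L * phimax * sigma ^+ 2) / phimax =
      sigma ^+ 2 * (36 * (#|S|%:R * L)) by field; rewrite gt_eqF.
  have := @Q_oracle _ _ _ _ _ _ _ _ sim opt (X *m betas) S
    (8 * sigma ^+ 2 * ln (Y w)) SF.
  have := ler_wpM2l (sqr_ge0 sigma) (ln_bin_bound R p_gt0 (card_set_le S)).
  rewrite -/L yx => hbin /(_ _)/wrap[] => [T|hQ hL].
    have := noise_ge X (X *m betas) xi sigma_gt0 w T.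
    by rewrite /dev -y_def.
  rewrite mulrC ler_pdivrMr//.
  have -> : (A + 104 / 3 * v + 32 / 3 * v * ln (Y w)) * n%:R =
      4 / 3 * (36 * L * phimax * sigma ^+ 2 * s%:R / k ^+ 2
               + 26 * sigma ^+ 2 + 8 * sigma ^+ 2 * ln (Y w)).
    by rewrite /A /v; field; rewrite !gt_eqF.
  have penE : pen sigma S =
      sigma ^+ 2 * (26 * (ln ('C(p, #|S|)%:R : R) + #|S|%:R)).
    by rewrite /pen; ring.
  rewrite mulrDr in hbin; rewrite penE in hQ; lra.
have mY : measurable_fun setT Y by exact: measurable_noise.
have Y0 w : 0 < Y w by exact: noise_gt0.
have mYE : measurable_fun setT (EFin \o Y) by exact/measurable_EFinP.
have EY : (\int[P]_w (Y w)%:E <= 2%:E)%E by exact: expectation_noise.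
have merr : measurable_fun setT err.
  rewrite (funext errE); apply: measurable_funM => //.
  apply: measurable_sum => i; under eq_fun do rewrite !mxE.
  by apply: measurable_funM; exact: measurable_funB.
have err0 w : 0 <= err w by rewrite errE mulr_ge0 ?invr_ge0 ?dotv_ge0// ltW.
have B0 : 0 <= 128 * sigma ^+ 2 * s%:R / (k ^+ 2 * n%:R).
  by rewrite divr_ge0 ?mulr_ge0 ?exprn_ge0// ltW.
have split_rate : (128 + 48 * phimax) * sigma ^+ 2 * s%:R * L / (k ^+ 2 * n%:R) =
    128 * sigma ^+ 2 * s%:R / (k ^+ 2 * n%:R) * L + A.
  by rewrite /A; field; rewrite !gt_eqF.
split=> [x x0|].
  set bnd := (X in [set w | _ <= X]).
  have bndE : bnd = 128 * sigma ^+ 2 * s%:R / (k ^+ 2 * n%:R) * L + A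
      + 24 * v + 128 * sigma ^+ 2 * s%:R / (k ^+ 2 * n%:R) * x + 22 * v * x.
    rewrite /bnd -/k -/L split_rate /v; ring.
  (* For [x < 1], [3 exp(-x) > 3 / e > 1], so the claimed lower bound is negative. *)
  have [x1|x1] := ltP x 1.
    apply: (@lt_le_trans _ _ 0%E) => //.
    have := expRN1_gt R; have : expR (-1) < expR (- x) by rewrite ltr_expR ltrN2.
    rewrite lte_fin; lra.
  pose G := [set w | err w <= bnd].
  have mG : measurable G.
    rewrite -[G]setTI (_ : G = err @^-1` `]-oo, bnd]%classic).
      exact: merr.
    by apply/seteqP; split => w /=; rewrite in_itv.
  (* If [ln (Y w) <= x], then [104/3 + 32/3 x <= 24 + 22 x], true for [x >= 16/17], puts [w] in
     [G]. *)
  have GY w : (~` G) w -> expR x <= Y w.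
    move=> /negP; apply: contraNle => Yx.
    have lnY : ln (Y w) <= x by rewrite -[leRHS]expRK ler_ln ?posrE ?expR_gt0 ?ltW.
    rewrite (le_trans (err_le w))// bndE.
    have := ler_wpM2l (ltW v0) lnY; have := ler_wpM2l (ltW v0) x1.
    have := mulr_ge0 B0 L0; have := mulr_ge0 B0 (ltW x0); lra.
  (* Markov's inequality for [Y], of mean at most 2; the gap between 2 and 3 makes the final
     inequality strict. *)
  have PG : (P (~` G) <= (2 * expR (- x))%:E)%E.
    have e0 : 0 < expR x by exact: expR_gt0.
    have : ((expR x)%:E * P (~` G) <= 2%:E)%E.
      apply: le_trans EY; rewrite -[~` G]setIT -integral_indic//; last first.
        exact: measurableC.
      rewrite -ge0_integralZl//; last first.
        by apply/measurable_EFinP; apply: measurable_indic; exact: measurableC.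
      apply: ge0_le_integral => //.
      - apply/measurable_EFinP; apply: measurable_funM => //.
        by apply: measurable_indic; exact: measurableC.
      - move=> w _; rewrite -EFinM lee_fin indicE.
        have [/set_mem/GY|_] := boolP (w \in ~` G); first by rewrite mulr1.
        by rewrite mulr0 ltW.
    rewrite -[P _]fineK ?fin_num_measure//; last exact: measurableC.
    rewrite -EFinM !lee_fin expRN => h.
    by rewrite ler_pdivlMr// mulrC.
  change (((1 - 3 * expR (- x))%:E < P G)%E).
  rewrite -[G]setCK probability_setC//; last exact: measurableC.
  move: PG; rewrite -[P _]fineK ?fin_num_measure//; last exact: measurableC.
  have ex := expR_gt0 (- x).
  rewrite lee_fin => PG; rewrite -EFinB lte_fin; lra.
rewrite unlock -/err.
(* [ln Y <= Y] and the mean bound 2 give the constant [104/3 + 64/3 = 56], below 90. *)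
pose C := A + 104 / 3 * v; pose D := 32 / 3 * v.
have C0 : 0 <= C by rewrite addr_ge0// mulr_ge0// ltW.
have D0 : 0 <= D by rewrite mulr_ge0// ltW.
have mDY : measurable_fun setT (fun w => D%:E * (Y w)%:E)%E.
  by apply/measurable_EFinP; exact: measurable_funM.
apply: (@le_trans _ _ (\int[P]_w (C%:E + D%:E * (Y w)%:E))%E).
  apply: ge0_le_integral => //.
  - by move=> w _; rewrite lee_fin; exact: err0.
  - exact/measurable_EFinP.
  - by apply/measurable_EFinP; apply: measurable_funD => //; exact: measurable_funM.
  - move=> w _; rewrite -EFinM -EFinD lee_fin (le_trans (err_le w))// lerD2l.
    by rewrite ler_wpM2l// ltW// ln_sublinear.
have DY0 w : setT w -> (0 <= D%:E * (Y w)%:E)%E.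
  by move=> _; rewrite mule_ge0// lee_fin// ltW.
rewrite ge0_integralD// integral_cst//.
rewrite [X in (_ * X)%E](_ : _ = 1%E); last exact: probability_setT.
rewrite mule1 ge0_integralZl//; last first.
  by move=> w _; rewrite lee_fin ltW.
apply: (@le_trans _ _ (C%:E + D%:E * 2%:E)%E).
  by rewrite leeD2l// lee_wpmul2l.
rewrite -EFinM -EFinD lee_fin -/k -/L split_rate /C /D.
have -> : 384 * sigma ^+ 2 * s%:R / (k ^+ 2 * n%:R) =
  3 * (128 * sigma ^+ 2 * s%:R / (k ^+ 2 * n%:R)) by field; rewrite !gt_eqF.
rewrite -[90 * _ / _]mulrA -/v.
have := mulr_ge0 B0 L0; lra.
Qed.
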